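(* Assume (A1) and (A2). Moreover, let $\sigma$ be Lipschitz on $\mathbb R^n$. Let $0<t_*\le T$ and suppose that $\ell(t_*,x)$ is a singleton for every point $(t_*,x)$ of the plane $\Delta^{t_*}=\{(t_*,x)\in\mathbb R^{n+1}: x\in\mathbb R^n\}$. Then the viscosity solution $u(t,x)=\max_{q\in\mathbb R^n}\{\langle x,q\rangle-\sigma^*(q)-\int_0^tH(\tau,q)\,d\tau\}$, defined by the Hopf-type formula, of the problem $u_t+H(t,D_xu)=0$ in $\Omega$, $u(0,x)=\sigma(x)$ on $\mathbb R^n$, is continuously differentiable in the open strip $(0,t_* )\times\mathbb R^n$.
   Context: Let $T>0$ and $\Omega=(0,T)\times\mathbb R^n$. Let $H=H(t,p)$ be a real-valued function of class $C^1$ on $[0,T]\times\mathbb R^n$ and $\sigma:\mathbb R^n\to\mathbb R$ be convex and of class $C^1$. $\sigma^*:\mathbb R^n\to\mathbb R\cup\{+\infty\}$ is the Fenchel conjugate of $\sigma$. Condition (A1): for every $(t_0,x_0)\in[0,T)\times\mathbb R^n$ there exist positive constants $r$ and $N$ such that $$\langle x,p\rangle-\sigma^*(p)-\int_0^tH(\tau,p)\,d\tau<\max_{|q|\le N}\Big\{\langle x,q\rangle-\sigma^*(q)-\int_0^tH(\tau,q)\,d\tau\Big\}$$ whenever $(t,x)\in[0,T)\times\mathbb R^n$, $|t-t_0|+|x-x_0|<r$ and $|p|>N$. Condition (A2): $H$ has one of the two following forms: a) $H(t,\cdot)$ is convex for all $t\in(0,T)$, or $H(t,\cdot)$ is concave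 for all $t\in(0,T)$; b) $H(t,p)=g(t)h(p)+k(t)$ for some functions $g,h,k$, where $g(t)$ does not change its sign on $(0,T)$. It is known that under (A1) and (A2) the function $u$ is a viscosity solution of the stated Cauchy problem. For $(t,x)\in(0,T]\times\mathbb R^n$, $\ell(t,x)$ is the set of all $p\in\mathbb R^n$ at which the function $q\mapsto\langle x,q\rangle-\sigma^*(q)-\int_0^tH(\tau,q)\,d\tau$ attains its maximum over $\mathbb R^n$. *)

(* Defs.v *)
From HB Require Import structures.
From mathcomp Require Import all_boot all_order all_algebra.
From mathcomp Require Import all_classical all_reals all_analysis.

Set Implicit Arguments.
Unset Strict Implicit.
Unset Printing Implicit Defensive.

Import Order.TTheory GRing.Theory Num.Theory.
Import numFieldNormedType.Exports.

Local Open Scope classical_set_scope.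
Local Open Scope ring_scope.

Definition dot (R : realType) (n : nat) (x y : 'rV[R]_n) : R :=
  \sum_(i < n) x 0 i * y 0 i.

(* The library norm `|x| on 'rV[R]_n is the sup norm; quantitative bounds below
   use the Euclidean one. *)
Definition enorm (R : realType) (n : nat) (x : 'rV[R]_n) : R :=
  Num.sqrt (dot x x).

(* Meant for open A. The spaces V used are finite dimensional, so continuity of
   all directional derivatives is continuity of z |-> 'd f z. *)
Definition C1_open (R : realType) (V : normedModType R) (A : set V)
    (f : V -> R) : Prop :=
  (forall z, A z -> differentiable f z) /\
  (forall v z, A z -> {for z, continuous ('D_v f)}).

(* Class C^1 on a set that need not be open: a differential relative to A exists
   at each point of A (one-sided at the boundary) and is continuous on A. *)
Definition C1_within (R : realType) (V : normedModType R) (A : set V)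
    (f : V -> R) : Prop :=
  exists df : V -> {linear V -> R^o},
    (forall v, {within A, continuous (fun z => df z v : R)}) /\
    (forall z, A z ->
      (f w - f z - df z (w - z)) / `|w - z| @[w --> within A z^'] --> (0 : R)).

Definition time_slab (R : realType) (n : nat) (I : set R) :
  set (R * 'rV[R]_n) := [set z | I z.1].

Definition fenchel_conjugate (R : realType) (n : nat) (sigma : 'rV[R]_n -> R)
    (p : 'rV[R]_n) : \bar R :=
  ereal_sup [set (dot x p - sigma x)%:E | x in [set: 'rV[R]_n]].

(* Values lie in R or are -oo: the conjugate of a real-valued function is never
   -oo. *)
Definition hopf_term (R : realType) (n : nat) (H : R -> 'rV[R]_n -> R)
    (sigma : 'rV[R]_n -> R) (t : R) (x q : 'rV[R]_n) : \bar R :=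
  ((dot x q)%:E - fenchel_conjugate sigma q
   - (\int[lebesgue_measure]_(tau in `[0%R, t]) H tau q)%:E)%E.

(* The maximum over the ball is written as a supremum: it is attained by upper
   semicontinuity of hopf_term in q. *)
Definition condA1 (R : realType) (n : nat) (T : R) (H : R -> 'rV[R]_n -> R)
    (sigma : 'rV[R]_n -> R) : Prop :=
  forall (t0 : R) (x0 : 'rV[R]_n), 0 <= t0 < T ->
  exists r N : R, [/\ 0 < r, 0 < N &
    forall (t : R) (x p : 'rV[R]_n), 0 <= t < T ->
      `|t - t0| + enorm (x - x0) < r -> N < enorm p ->
      (hopf_term H sigma t x p <
       ereal_sup [set hopf_term H sigma t x q | q in [set q | (enorm q <= N)%R]])%E].

Definition condA2 (R : realType) (n : nat) (T : R) (H : R -> 'rV[R]_n -> R) :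
    Prop :=
  ((forall t, 0 < t < T -> convex_function setT (H t)) \/
   (forall t, 0 < t < T -> convex_function setT (fun p => - H t p))) \/
  (exists (g : R -> R) (h : 'rV[R]_n -> R) (k : R -> R),
    (forall t p, 0 <= t <= T -> H t p = g t * h p + k t) /\
    ((forall t, 0 < t < T -> 0 <= g t) \/ (forall t, 0 < t < T -> g t <= 0))).

(* The supremum is a maximum, with a real value, at every (t, x) with
   0 <= t < T when condA1 holds. *)
Definition hopf_solution (R : realType) (n : nat) (H : R -> 'rV[R]_n -> R)
    (sigma : 'rV[R]_n -> R) (t : R) (x : 'rV[R]_n) : R :=
  fine (ereal_sup [set hopf_term H sigma t x q | q in [set: 'rV[R]_n]]).

Definition ell (R : realType) (n : nat) (H : R -> 'rV[R]_n -> R)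
    (sigma : 'rV[R]_n -> R) (t : R) (x : 'rV[R]_n) : set 'rV[R]_n :=
  [set p | forall q, (hopf_term H sigma t x q <= hopf_term H sigma t x p)%E].

(* Main.v *)
Require Import Defs.
From HB Require Import structures.
From mathcomp Require Import all_boot all_order all_algebra.
From mathcomp Require Import all_classical all_reals all_analysis.
From mathcomp Require Import ring lra.

Set Implicit Arguments.
Unset Strict Implicit.
Unset Printing Implicit Defensive.

Import Order.TTheory GRing.Theory Num.Theory.
Import numFieldNormedType.Exports.

Local Open Scope classical_set_scope.
Local Open Scope ring_scope.

(* Write h_t(q) for the integral of H(., q) over [0, t] and f_t = sigma^* + h_t,
   so that u(t, x) = max_q (<x, q> - f_t(q)). As sigma is Lipschitz, the domain
   of sigma^* is bounded, hence the maximum is attained; where the maximiser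
   p(t, x) is unique it is continuous in (t, x), and a Danskin argument gives
   D_x u = p and u_t = - H(t, p). Everything thus reduces to uniqueness of the
   maximiser for 0 < t0 < tstar.

   Brouwer's theorem (surjectivity of the characteristics) is avoided by the
   following observation: since all maximisers at time tstar are unique, f_tstar
   is convex. Under (A2), f_t0 is then a f + c, where a > 0, c is convex, f is
   sigma^* or f_tstar, and f_t0 - f is differentiable: a = 1 and f = sigma^* when
   H is convex, a = 1 and f = f_tstar when H is concave, while for
   H = g(t) h(p) + k(t) with G(t) the integral of g one has, up to a constant,
   f_t0 = (1 - l) sigma^* + l f_tstar with l = G(t0) / G(tstar) in [0, 1]. If p
   and p' both maximise <x, .> - f_t0, then f is affine on [p, p'] and the
   midpoint m maximises <y, .> - f for y = x - grad (f_t0 - f)(m), hence so do p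
   and p', which forces p = p'. *)

(** * Dot product and its comparison with the sup norm *)

Section dot_product.
Context {R : realType} {n : nat}.
Implicit Types x y z : 'rV[R]_n.

Lemma dotDl x y z : dot (x + y) z = dot x z + dot y z.
Proof. by rewrite /dot -big_split; apply: eq_bigr => i _; rewrite mxE mulrDl. Qed.

Lemma dotZl (a : R) x y : dot (a *: x) y = a * dot x y.
Proof. by rewrite /dot mulr_sumr; apply: eq_bigr => i _; rewrite mxE mulrA. Qed.

Lemma dotC x y : dot x y = dot y x.
Proof. by apply: eq_bigr => i _; rewrite mulrC. Qed.

Lemma dotDr x y z : dot z (x + y) = dot z x + dot z y.
Proof. by rewrite dotC dotDl !(dotC z). Qed.

Lemma dotZr (a : R) x y : dot x (a *: y) = a * dot x y.
Proof. by rewrite dotC dotZl dotC. Qed.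

Lemma dotNl x y : dot (- x) y = - dot x y.
Proof. by rewrite -scaleN1r dotZl mulN1r. Qed.

Lemma dotNr x y : dot x (- y) = - dot x y.
Proof. by rewrite dotC dotNl dotC. Qed.

Lemma dotBl x y z : dot (x - y) z = dot x z - dot y z.
Proof. by rewrite dotDl dotNl. Qed.

Lemma dotBr x y z : dot z (x - y) = dot z x - dot z y.
Proof. by rewrite dotDr dotNr. Qed.

Lemma dot0l x : dot 0 x = 0.
Proof. by rewrite -(scale0r 0) dotZl mul0r. Qed.

Lemma dot_delta i x : dot (delta_mx 0 i) x = x 0 i.
Proof.
rewrite /dot (bigD1 i)//= mxE !eqxx mul1r big1 ?addr0// => j ji.
by rewrite mxE (negbTE ji) andbF mul0r.
Qed.

Lemma dot_ge0 x : 0 <= dot x x.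
Proof. by apply: sumr_ge0 => i _; rewrite -expr2 sqr_ge0. Qed.

Lemma ler_norm_coord x i : `|x 0 i| <= `|x|.
Proof. by rewrite {2}/Num.norm/= mx_normrE (le_bigmax _ _ (0, i)). Qed.

Lemma norm_rV_le x (M : R) : 0 <= M -> (forall i, `|x 0 i| <= M) -> `|x| <= M.
Proof.
move=> M0 xM; rewrite {1}/Num.norm/= mx_normrE.
by apply: bigmax_le => // -[i j] _; rewrite ord1.
Qed.

(** Each squared coordinate is one term of the sum of squares. Euclidean estimates below pass to the
    sup norm through this bound. *)
Lemma sqr_norm_le_dot x : `|x| ^+ 2 <= dot x x.
Proof.
rewrite -[dot x x]sqr_sqrtr ?dot_ge0// lerXn2r ?nnegrE ?sqrtr_ge0//.
apply: norm_rV_le => [|i]; first exact: sqrtr_ge0.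
rewrite -sqrtr_sqr ler_wsqrtr// /dot (bigD1 i)//= -expr2 lerDl.
by apply: sumr_ge0 => j _; rewrite -expr2 sqr_ge0.
Qed.

Lemma dot_le_norm x y : `|dot x y| <= n%:R * `|x| * `|y|.
Proof.
rewrite /dot (le_trans (ler_norm_sum _ _ _))//.
rewrite -mulrA -[n in n%:R](card_ord n) mulr_natl -sumr_const.
by apply: ler_sum => i _; rewrite normrM ler_pM// ler_norm_coord.
Qed.

Lemma cvg_dot {T : Type} (F : set_system T) {FF : Filter F}
    (f g : T -> 'rV[R]_n) x y :
  f @ F --> x -> g @ F --> y -> dot (f t) (g t) @[t --> F] --> dot x y.
Proof.
move=> fx gy; rewrite /dot; apply: cvg_big => [|i _]; first exact: add_continuous.
apply: cvgM.
- apply: (cvg_comp f (fun v : 'rV[R]_n => v 0 i) fx).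
  exact: coord_continuous.
- apply: (cvg_comp g (fun v : 'rV[R]_n => v 0 i) gy).
  exact: coord_continuous.
Qed.

End dot_product.

(** * Integrals over [0, t] as functions of t *)

Section primitive.
Context {R : realType}.
Notation mu := (@lebesgue_measure R).
Implicit Types f g : R -> R.

Definition prim f (t : R) : R := \int[mu]_(tau in `[0, t]) f tau.

Lemma integrable_itvcc f a b : continuous f ->
  mu.-integrable `[a, b] (EFin \o f).
Proof.
move=> cf; apply: continuous_compact_integrable; first exact: segment_compact.
exact: continuous_subspaceT.
Qed.

Lemma primD f g t : continuous f -> continuous g ->
  prim (fun x => f x + g x) t = prim f t + prim g t.
Proof. by move=> cf cg; rewrite /prim RintegralD//; exact: integrable_itvcc. Qed.

Lemma primZ c f t : continuous f -> prim (fun x => c * f x) t = c * prim f t.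
Proof. by move=> cf; rewrite /prim RintegralZl//; exact: integrable_itvcc. Qed.

Lemma primB f g t : continuous f -> continuous g ->
  prim (fun x => f x - g x) t = prim f t - prim g t.
Proof. by move=> cf cg; rewrite /prim RintegralB//; exact: integrable_itvcc. Qed.

Lemma prim_cst c t : 0 <= t -> prim (fun=> c) t = c * t.
Proof.
move=> t0; rewrite /prim Rintegral_cst//= lebesgue_measure_itv/= lte_fin.
by case: ltgtP t0 => // [_|<-] _; rewrite ?oppr0 ?addr0 ?subr0// mulr0.
Qed.

Lemma prim_increment f a b : continuous f -> 0 <= a <= b ->
  prim f b - prim f a = \int[mu]_(tau in `]a, b[) f tau.
Proof.
move=> cf /andP[a0 ab]; rewrite /prim Rintegral_itvB ?bnd_simp//; last first.
  exact: integrable_itvcc.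
rewrite -Rintegral_itv_bndo_bndc//.
apply: integrableS (integrable_itvcc a b cf) => //.
by move=> x /=; rewrite !in_itv/= => /andP[/ltW-> /ltW->].
Qed.

(** Endpoints are left out of the comparison because (A2) gives convexity and sign only for 0 < t <
    T. *)
Lemma prim_increment_le f g a b : continuous f -> continuous g -> 0 <= a <= b ->
  (forall t, a < t < b -> f t <= g t) ->
  prim f b - prim f a <= prim g b - prim g a.
Proof.
have int_oo h : continuous h -> mu.-integrable `]a, b[ (EFin \o h).
  move=> ch; apply: integrableS (integrable_itvcc a b ch) => //.
  by move=> x /=; rewrite !in_itv/= => /andP[/ltW-> /ltW->].
move=> cf cg ab fg; rewrite !prim_increment//.
apply: le_Rintegral; [by []|exact: int_oo|exact: int_oo|].
by move=> x; rewrite /= in_itv/=; exact: fg.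
Qed.

Lemma prim0 f : prim f 0 = 0.
Proof. by rewrite /prim set_itv1 Rintegral_set1. Qed.

Lemma prim_increment_le_cst f M a b : continuous f -> 0 <= a <= b ->
  (forall t, a < t < b -> f t <= M) -> prim f b - prim f a <= M * (b - a).
Proof.
move=> cf /andP[a0 ab] fM.
have := @prim_increment_le f (fun=> M) a b cf (@cst_continuous _ _ M).
by rewrite a0 ab !prim_cst ?(le_trans a0)// -mulrBr; exact.
Qed.

(** A quantitative fundamental theorem of calculus, valid for both orders of [a] and [b]. It yields
    time derivatives when [c] is a value of [f], and plain bounds when [c] is 0. *)
Lemma prim_increment_dist f c e a b : continuous f -> 0 <= a -> 0 <= b ->
  (forall t, Num.min a b < t < Num.max a b -> `|f t - c| <= e) ->
  `|prim f b - prim f a - c * (b - a)| <= e * `|b - a|.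
Proof.
move=> cf; wlog ab : a b / a <= b => [hw a0 b0 fe|].
  have [ab|/ltW ba] := leP a b; first exact: hw.
  rewrite -normrN (distrC b).
  have := hw _ _ ba b0 a0; rewrite minC maxC => /(_ fe).
  by congr (`|_| <= _); ring.
rewrite (min_idPl ab) (max_idPr ab) => a0 b0 fe.
rewrite [X in _ <= _ * X]ger0_norm ?subr_ge0//.
have h1 := @prim_increment_le_cst f (c + e) a b cf.
have h2 := @prim_increment_le (fun=> c - e) f a b (@cst_continuous _ _ _) cf.
rewrite ab a0 in h1 h2; rewrite !prim_cst// in h2.
rewrite ler_norml; apply/andP; split.
  have : (c - e) * b - (c - e) * a <= prim f b - prim f a.
    by apply: h2 => // t /fe; rewrite ler_distl => /andP[].
  by nra.
have : prim f b - prim f a <= (c + e) * (b - a).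
  by apply: h1 => // t /fe; rewrite ler_distl => /andP[].
by nra.
Qed.

End primitive.

(** * Pointwise arithmetic of continuous real functions *)

Section continuous_arith.
Context {R : realType} {T : topologicalType}.
Implicit Types f g : T -> R.

Lemma continuous_rD f g : continuous f -> continuous g ->
  continuous (fun x => f x + g x).
Proof. by move=> cf cg x; apply: cvgD; [exact: cf|exact: cg]. Qed.

Lemma continuous_rB f g : continuous f -> continuous g ->
  continuous (fun x => f x - g x).
Proof. by move=> cf cg x; apply: cvgB; [exact: cf|exact: cg]. Qed.

Lemma continuous_rM f g : continuous f -> continuous g ->
  continuous (fun x => f x * g x).
Proof. by move=> cf cg x; apply: cvgM; [exact: cf|exact: cg]. Qed.

End continuous_arith.

(** * Existence and stability of minimisers over a bounded domain *)

Section minimization.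
Context {R : realType} {V : normedModType R}.
Implicit Types (D : set V) (f g : V -> R).

(* Closedness of the epigraph of [f] extended by [+oo] outside [D]. *)
Definition lsc_on D f :=
  forall g, continuous g -> closed [set q | D q /\ f q <= g q].

Definition argmin_on D f := [set p | D p /\ forall q, D q -> f p <= f q].

Definition convex_on D f := forall a b l, D a -> D b -> 0 <= l <= 1 ->
  D (l *: a + (1 - l) *: b) /\
  f (l *: a + (1 - l) *: b) <= l * f a + (1 - l) * f b.

Lemma lsc_on_closed D f (c : R) :
  lsc_on D f -> closed [set q | D q /\ f q <= c].
Proof. by apply=> x; exact: cvg_cst. Qed.

Lemma lsc_onD D f g : lsc_on D f -> continuous g ->
  lsc_on D (fun q => f q + g q).
Proof.
move=> lf cg k ck.
have -> : [set q | D q /\ f q + g q <= k q] = [set q | D q /\ f q <= k q - g q].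
  by apply/seteqP; split => q [Dq h]; split => //; move: h; rewrite lerBrDr.
by apply: lf => x; apply: cvgB; [exact: ck|exact: cg].
Qed.

(** The set is an intersection of closed sets, one per index. This is the lower semicontinuity of a
    supremum of continuous functions. *)
Lemma closed_sup_le (I : Type) (P : set I)
    (phi : I -> V -> R) g :
  (forall i, P i -> continuous (phi i)) -> continuous g ->
  closed [set x | forall i, P i -> phi i x <= g x].
Proof.
move=> cphi cg.
have -> : [set x | forall i, P i -> phi i x <= g x] =
    \bigcap_(i in P) [set x | 0 <= g x - phi i x].
  by apply/seteqP; split => x h i Pi; move: (h i Pi); rewrite /= subr_ge0.
apply: closed_bigI => i Pi.
apply: (@closed_comp _ _ (fun x => g x - phi i x) [set y | 0 <= y]).
  by move=> x _; apply: cvgB; [exact: cg|exact: cphi].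
exact: closed_ge.
Qed.

Hypothesis compact_norm_le : forall M : R, compact [set p : V | `|p| <= M].

(** The sublevel sets at values of [f] on [D] form a filter base inside a compact ball. A cluster
    point lies in each of them, since they are closed, and so minimises [f]. *)
Lemma argmin_on_nonempty D f (L : R) : D !=set0 ->
  (forall p, D p -> `|p| <= L) -> lsc_on D f -> argmin_on D f !=set0.
Proof.
move=> [r0 Dr0] DL lf.
pose B r := [set q | D q /\ f q <= f r].
pose F := filter_from D B.
have FF : ProperFilter F.
  apply: filter_from_proper; last by move=> r Dr; exists r; split.
  apply: filter_from_filter; first by exists r0.
  move=> r1 r2 D1 D2; have [le12|/ltW le21] := leP (f r1) (f r2).
    by exists r1 => // q [Dq qr]; split; split => //; exact: le_trans le12.
  by exists r2 => // q [Dq qr]; split; split => //; exact: le_trans le21.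
have FK : F [set p : V | `|p| <= L] by exists r0 => // q [/DL].
have [p [_ clp]] := compact_norm_le FF FK.
have pB r : D r -> B r p.
  move=> Dr; have cB : closed (B r) by exact: (@lsc_on_closed D f (f r) lf).
  by apply: cB => U Up; apply: clp => //; exists r.
by exists p; split => [|q Dq]; [have [] := pB _ Dr0 | have [] := pB _ Dq].
Qed.

(** The minimisers stay in a compact ball, so it suffices that each cluster point of [p] at [z0]
    minimises the limit problem; uniqueness then leaves only [p0]. *)
Lemma argmin_on_cvg (Z : topologicalType) D (L : R) f (psi : Z -> V -> R)
    (p : Z -> V) z0 p0 :
  (forall p, D p -> `|p| <= L) -> lsc_on D f ->
  (forall q, psi zq.1 zq.2 @[zq --> (z0, q)] --> psi z0 q) ->
  (\forall z \near z0, argmin_on D (fun q => f q + psi z q) (p z)) ->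
  argmin_on D (fun q => f q + psi z0 q) `<=` [set p0] ->
  p @ z0 --> p0.
Proof.
move=> DL lf cpsi pmin p0min.
have pK : (p @ z0) [set q : V | `|q| <= L].
  by apply: filterS pmin => z [/DL].
have clmin q : cluster (p @ z0) q -> argmin_on D (fun q => f q + psi z0 q) q.
  move=> clq.
  (* The slack [e] pays for replacing [psi z'] by [psi z0], half at the cluster point [q] and half
     at the competitor [r]. Closedness of a sublevel set then carries the bound from nearby
     minimisers [p z'] to [q]. *)
  suff clr r e : D r -> 0 < e -> D q /\ f q <= f r + psi z0 r - psi z0 q + e.
    have [z [Dpz _]] := filter_ex pmin.
    have [Dq _] := clr _ 1 Dpz ltr01.
    split => // r Dr; apply/ler_addgt0Pr => e e0.
    by have [_] := clr r e Dr e0; rewrite addrAC lerBrDr addrC.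
  move=> Dr e0; set c := _ + e.
  have cS := @lsc_on_closed D f c lf.
  apply: cS => B qB.
  have e20 : 0 < e / 2 by rewrite divr_gt0.
  have /cvgrPdist_lt /(_ _ e20) [[A1 B1] [/= zA1 qB1] AB1] := cpsi q.
  have /cvgrPdist_lt /(_ _ e20) [[A2 B2] [/= zA2 rB2] AB2] := cpsi r.
  have [||q' [/= [z' [pz' zA1' zA2'] <-] [B1q' Bq']]] :=
      clq (p @` [set z | [/\ argmin_on D (fun q => f q + psi z q) (p z), A1 z &
                        A2 z]]) (B1 `&` B).
  - apply: filterS (filterI pmin (filterI zA1 zA2)) => z [? []] ? ?.
    by exists z.
  - exact: filterI.
  exists (p z'); split => //; case: pz' => Dpz' /(_ r Dr) le_r; split => //.
  have := AB1 (z', p z') (conj zA1' B1q').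
  have := AB2 (z', r) (conj zA2' (nbhs_singleton rB2)).
  rewrite /= !ltr_norml /c => /andP[? ?] /andP[? ?]; lra.
have [q [_ clq]] := compact_norm_le (fmap_proper_filter p _) pK.
have q0 := p0min _ (clmin _ clq); rewrite /= in q0; subst q.
have Dp0 := (clmin _ clq).1.
(* The radius grows by 1 so that the compact ball is a neighbourhood of [p0]. *)
apply: (@compact_cluster_set1 V p0 _ [set q : V | `|q| <= L + 1]) => //.
- apply/nbhs_ballP; exists 1 => //= x; rewrite -ball_normE /= => h.
  rewrite -(subrK p0 x) (le_trans (ler_normD _ _))// addrC lerD ?DL//.
  by rewrite distrC ltW.
- by apply: filterS pK => z /= /le_trans; apply; rewrite lerDl.
- by apply/seteqP; split => [x /clmin/p0min//|x -> //].
Qed.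

End minimization.

(** * Unique minimisers and convexity *)

Section unique_minimizers.
Context {R : realType} {n : nat}.
Notation V := 'rV[R]_n.
Implicit Types (D : set V) (f : V -> R).

Lemma compact_norm_le (M : R) : compact [set p : V | `|p| <= M].
Proof.
apply: bounded_closed_compact.
  by exists M; split => [|x Mx p /= /le_trans]; [exact: num_real|apply; exact: ltW].
apply: (@closed_comp _ _ (fun p : V => `|p|) [set y | y <= M]).
  by move=> x _; exact: norm_continuous.
exact: closed_le.
Qed.

Lemma dot_continuous (x : V) : continuous (dot x : V -> R).
Proof.
move=> q.
exact: (@cvg_dot R n V (nbhs q) _ (cst x) id x q (cvg_cst _) cvg_id).
Qed.

Lemma dotr_continuous (x : V) : continuous (fun y : V => dot y x).
Proof. by under eq_fun do rewrite dotC; exact: dot_continuous. Qed.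

Lemma dot_sqr_continuous : continuous (fun x : V => dot x x).
Proof.
by move=> x; exact: (@cvg_dot R n V (nbhs x) _ id id x x cvg_id cvg_id).
Qed.

(** The cost is decomposed in two ways: the convex remainder [C] in a F + C forces [F] to be affine
    between two minimisers, while in F + S the term [S] can be linearised at their midpoint. *)
Lemma unique_argmin_sum D (F S C : V -> R) (a : R) (x p p' : V) : 0 < a ->
  convex_on D F -> convex_on D C ->
  (forall q, D q -> F q + S q = a * F q + C q) ->
  (forall m : V, exists y, forall (v : V) (e : R), 0 < e ->
     \forall s \near 0^'+, S (m + s *: v) - S m <= s * (dot y v + e)) ->
  (forall y q q' : V, argmin_on D (fun q => F q - dot y q) q ->
    argmin_on D (fun q => F q - dot y q) q' -> q = q') ->
  argmin_on D (fun q => F q + S q - dot x q) p ->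
  argmin_on D (fun q => F q + S q - dot x q) p' -> p = p'.
Proof.
move=> a0 cF cC FSC dS uF [Dp pmin] [Dp' pmin'].
have h2 : 0 <= (2^-1 : R) <= 1 by lra.
have [Dm Fm] := cF _ _ _ Dp Dp' h2; have [_ Cm] := cC _ _ _ Dp Dp' h2.
set m := _ *: p + _ in Dm Fm Cm.
have dotm z : dot z m = 2^-1 * dot z p + (1 - 2^-1) * dot z p'.
  by rewrite dotDr !dotZr.
clearbody m.
have := pmin _ Dp'; have := pmin' _ Dp; have := pmin _ Dm.
rewrite !FSC// (dotm x) => hm hp' hp.
(* The average of the two minimal costs is at most the cost at [m]; convexity of [C] cancels its
   share, and division by [a] leaves the reverse of convexity for [F]. *)
have Fm_ge : 2^-1 * F p + (1 - 2^-1) * F p' <= F m.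
  by rewrite -(ler_pM2l a0); nra.
have [y' y'P] := dS m.
pose y := x - y'.
(* The point [m] also minimises F + S - <x, .>. Compare it with m + s (q - m): [F] is bounded by
   convexity, [S] by its slope [y'], and division by s > 0 leaves an error [e]. *)
have mmin q : D q -> F m - dot y m <= F q - dot y q.
  move=> Dq; apply/ler_addgt0Pr => e e0.
  have : \forall s \near 0^'+, [/\ 0 < s, s < 1 &
      S (m + s *: (q - m)) - S m <= s * (dot y' (q - m) + e)] :> Prop.
    near=> s; split; [by []|by near: s; exact: nbhs_right_lt|].
    by near: s; exact: y'P.
  move=> /filter_ex [s [s0 s1 Ss]].
  have s01 : 0 <= s <= 1 by rewrite !ltW.
  have [Dqs Fqs] := cF _ _ _ Dq Dm s01.
  have qsE : s *: q + (1 - s) *: m = m + s *: (q - m).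
    by rewrite scalerBl scale1r scalerBr addrCA.
  have := pmin _ Dqs; rewrite qsE in Fqs *.
  have : F m + S m - dot x m <= F p + S p - dot x p.
    by rewrite !FSC// (dotm x); nra.
  move=> /le_trans h /h {h}; rewrite dotDr dotZr.
  rewrite dotBr in Ss; rewrite /y !dotBl dotBr => h.
  have : 0 <= s * (F q - F m + dot y' q - dot y' m + e - dot x q + dot x m) by lra.
  by rewrite pmulr_rge0//; lra.
(* By [Fm_ge] the minimum at [m] is at least the average of the values at [p] and [p'], so both
   values equal it. *)
have := mmin _ Dp; have := mmin _ Dp'; rewrite (dotm y) => mp' mp.
by apply: (uF y); split => // q /mmin; rewrite (dotm y); lra.
Unshelve. all: by end_near. Qed.

(* By Moreau-Yosida regularisation: with u the conjugate of f, the minimiser xe of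
   u - <., m> + e/2 |.|^2 satisfies p xe = m - e xe, and the minimal value bounds
   f (p xe) by the convex combination c; p xe tends to m with e, and f is lower
   semicontinuous. *)
Lemma unique_argmin_convex D f (L : R) : D !=set0 ->
  (forall p, D p -> `|p| <= L) -> lsc_on D f ->
  (forall x, exists p, argmin_on D (fun q => f q - dot x q) = [set p]) ->
  convex_on D f.
Proof.
move=> D0 DL lf /choice [p pE] a b l Da Db l01.
have [Dp pmin] : (forall x, D (p x)) /\
    (forall x q, D q -> f (p x) - dot x (p x) <= f q - dot x q).
  by split => x; have [] : argmin_on D (fun q => f q - dot x q) (p x) by rewrite pE.
set m := _ + _; set c := l * f a + _.
have cS := @lsc_on_closed R 'rV[R]_n D f c lf.
apply: cS.
pose u x := dot x (p x) - f (p x).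
have u_ge x : - c <= u x - dot x m.
  have ha := pmin x _ Da; have hb := pmin x _ Db.
  have /andP[l0 l1] := l01; rewrite /u /m dotDr !dotZr /c.
  have h0 : 0 <= 1 - l by lra.
  by have := ler_wpM2l l0 ha; have := ler_wpM2l h0 hb; lra.
clearbody m c.
have key e : 0 < e -> exists q, [/\ D q, f q <= c &
    `|m - q| ^+ 2 <= e * (c - f (p 0))].
  move=> e0; pose J x := u x + (e / 2 * dot x x - dot x m).
  have Jcont : continuous (fun x : V => e / 2 * dot x x - dot x m).
    apply: (@continuous_rB R V); last exact: dotr_continuous.
    apply: (@continuous_rM R V); last exact: dot_sqr_continuous.
    exact: (@cst_continuous V).
  (* [J] is defined on the whole space; restricting it to a sublevel set supplies the bounded domain
     that the existence lemma asks for. *)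
  pose B := [set x | J x <= J 0].
  have lJ : lsc_on B J.
    move=> g cg.
    have -> : [set x | B x /\ J x <= g x] =
        [set x | forall q, D q ->
           dot x q - f q + (e / 2 * dot x x - dot x m) <= J 0] `&`
        [set x | forall q, D q ->
           dot x q - f q + (e / 2 * dot x x - dot x m) <= g x].
      have JE x y : J x <= y <-> forall q, D q ->
          dot x q - f q + (e / 2 * dot x x - dot x m) <= y.
        split => [h q Dq|]; last by apply.
        apply: le_trans h; rewrite lerD2r /u.
        by have := pmin x _ Dq; lra.
      by apply/seteqP; split => x [] /JE h1 /JE h2.
    have phic q : D q -> continuous (fun x : V =>
        dot x q - f q + (e / 2 * dot x x - dot x m)).
      move=> _; apply: (@continuous_rD R V) => //.
      apply: (@continuous_rB R V); first exact: dotr_continuous.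
      exact: (@cst_continuous V).
    apply: closedI; apply: closed_sup_le => //; exact: (@cst_continuous V).
  (* On [B], [u_ge] gives e/2 |x|^2 <= J 0 + c, and |x| <= 1 + |x|^2. *)
  have [||xe [_ xemin]] := @argmin_on_nonempty R V compact_norm_le B J
      (1 + (J 0 + c) / (e / 2)) _ _ lJ.
  - by exists 0; exact: lexx.
  - move=> x Bx; have ux := u_ge x; have xx := sqr_norm_le_dot x.
    move: Bx; rewrite /B /= {1}/J => Jx.
    have : `|x| ^+ 2 <= (J 0 + c) / (e / 2) by rewrite ler_pdivlMr//; nra.
    by have := sqr_ge0 (`|x| - 1); nra.
  have {}xemin x : J xe <= J x.
    have [/xemin//|/ltW] := leP (J x) (J 0).
    by apply: le_trans; apply: xemin; rewrite /B /=.
  have pxe : p xe = m - e *: xe.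
    (* [w] is the gradient of [J] at [xe], since [p] is the gradient of [u]. Testing minimality
       along -w and using continuity of [p] on that line gives 0 <= - <w, w> in the limit. *)
    have [w wE] : exists w, w = p xe - m + e *: xe by exists (p xe - m + e *: xe).
    have pw : (fun s => p (xe + s *: - w)) @ (0 : R) --> p xe.
      apply: (@argmin_on_cvg R V compact_norm_le R D L f
        (fun s q => - dot (xe + s *: - w) q) (fun s => p (xe + s *: - w)) 0
        (p xe) DL lf).
      - move=> q; apply: cvgN; apply: (@cvg_dot R n (R * V)%type (nbhs ((0 : R), q)) _
            (fun sq => xe + sq.1 *: - w) snd (xe + 0 *: - w) q).
          apply: (@cvgD R V _ _ _ (cst xe)); first exact: cvg_cst.
          by apply: (@cvgZr_tmp R V); exact: cvg_fst.
        exact: cvg_snd.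
      - by near=> s; split => // q /(pmin (xe + s *: - w)).
      - by rewrite scale0r addr0 -pE.
    have {}pw : (fun s => p (xe + s *: - w)) @ (0 : R)^'+ --> p xe.
      exact: cvg_at_right_filter.
    have lim_w : (fun s : R => dot (- w) (p (xe + s *: - w)) + e * dot xe (- w)
        + s * (e / 2 * dot w w) - dot (- w) m) @ 0^'+ -->
        dot (- w) (p xe) + e * dot xe (- w) + 0 * (e / 2 * dot w w) - dot (- w) m.
      apply: cvgB; last exact: cvg_cst.
      apply: cvgD; last first.
        by apply: cvgM; [apply: cvg_at_right_filter; exact: cvg_id|exact: cvg_cst].
      by apply: cvgD; [exact: (cvg_dot (cvg_cst _) pw)|exact: cvg_cst].
    have : 0 <= dot (- w) (p xe) + e * dot xe (- w) + 0 * (e / 2 * dot w w)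
        - dot (- w) m.
      apply: cvgr_to_ge lim_w _; near=> s.
      have s0 : 0 < s by [].
      have := xemin (xe + s *: - w).
      have := pmin xe _ (Dp (xe + s *: - w)).
      rewrite /J /u !(dotDl, dotDr, dotZl, dotZr, dotNl, dotNr) (dotC xe w).
      move=> hp hx.
      have : 0 <= s * (- dot w (p (xe + s *: - w)) + e * - dot w xe
          + s * (e / 2 * dot w w) + dot w m) by lra.
      by rewrite pmulr_rge0//; lra.
    have -> : dot (- w) (p xe) + e * dot xe (- w) + 0 * (e / 2 * dot w w)
        - dot (- w) m = - dot w w.
      have -> : dot w w = dot w (p xe) - dot w m + e * dot w xe.
        by rewrite {2}wE dotDr dotBr dotZr.
      by rewrite (dotC xe) !dotNl; ring.
    rewrite oppr_ge0 => /(le_trans (sqr_norm_le_dot _)) w0.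
    have : w = 0.
      by apply/eqP; rewrite -normr_eq0 -sqrf_eq0 eq_le w0 sqr_ge0.
    by rewrite wE => /eqP; rewrite addr_eq0 subr_eq addrC => /eqP.
  (* This reads f (p xe) <= c - e <xe, xe>. As [p 0] minimises [f], also e <xe, xe> <= c - f (p 0),
     whence the bound on |e xe|^2. *)
  have := u_ge xe; rewrite /u pxe dotBr dotZr => h.
  exists (p xe); rewrite pxe; split => //.
  - by rewrite -pxe.
  - by have := dot_ge0 xe; nra.
  have := pmin 0 _ (Dp xe); rewrite !dot0l pxe !subr0 => h0.
  rewrite opprB addrCA subrr addr0.
  by rewrite (le_trans (sqr_norm_le_dot _))// dotZl dotZr; nra.
move=> U /nbhs_ballP [r /= r0 rU].
have C0 : 0 < `|c - f (p 0)| + 1 by rewrite ltr_wpDl.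
(* With this value of [e] the squared distance to [m] is at most r^2 / 2; the added 1 keeps the
   denominator positive. *)
have [|q [Dq fq mq]] := key (r ^+ 2 / 2 / (`|c - f (p 0)| + 1)).
  by rewrite !divr_gt0// exprn_gt0.
exists q; split => //; apply: rU; rewrite -ball_normE /=.
rewrite -(ltr_pXn2r (_ : 0 < 2)%N) ?nnegrE ?(ltW r0)//.
rewrite (le_lt_trans mq)// mulrAC ltr_pdivrMr//.
have := ler_norm (c - f (p 0)); have := exprn_gt0 2 r0; nra.
Unshelve. all: by end_near.
Qed.

End unique_minimizers.

(** * Integrals over [0, t] depending on a parameter *)

Section smooth_integrand.
Context {R : realType} {n : nat}.
Notation V := 'rV[R]_n.

Lemma linear_form_dot (l : V -> R) :
  (forall (a : R) (u v : V), l (a *: u + v) = a * l u + l v) ->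
  exists y, forall v, l v = dot y v.
Proof.
move=> llin; pose y : V := \row_i l (delta_mx 0 i).
have l0 : l 0 = 0 by have := llin 1 0 0; rewrite scale1r addr0; lra.
exists y => v; rewrite {1}[v]row_sum_delta /dot.
apply: (big_ind2 (fun w r => l w = r)) => // [u r w r' <- <-|i _].
  by have := llin 1 u w; rewrite scale1r mul1r.
by have := llin (v 0 i) (delta_mx 0 i) 0; rewrite !addr0 l0 addr0 mxE mulrC.
Qed.

Definition joint_continuous (G : R -> V -> R) :=
  forall t q, G z.1 z.2 @[z --> (t, q)] --> G t q.

(** Compactness of [0, b] makes continuity in [q] uniform in time, as in the tube lemma. *)
Lemma near_segment (G : R -> V -> R) (q0 : V) (b e : R) :
  joint_continuous G -> 0 < e ->
  \forall q \near q0, forall t, 0 <= t <= b -> `|G t q - G t q0| <= e.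
Proof.
move=> cG e0.
have /compact_near_coveringP /(_ V (nbhs q0)
  (fun q t => `|G t q - G t q0| <= e) _) := @segment_compact R 0 b.
have cov : forall x, `[0, b]%classic x -> \forall x' \near x & q \near q0,
    `|G x' q - G x' q0| <= e.
  move=> x _; have e20 : 0 < e / 2 by rewrite divr_gt0.
  have /cvgrPdist_lt /(_ _ e20) [[A B] [/= xA qB] AB] := cG x q0.
  exists (A, B) => // -[t q] /= [At Bq].
  have := AB (t, q) (conj At Bq); have := AB (t, q0) (conj At (nbhs_singleton qB)).
  by rewrite /= !ltr_norml ler_norml => /andP[? ?] /andP[? ?]; apply/andP; lra.
move=> /(_ cov); apply: filterS => q + t t0b; apply.
by rewrite /= in_itv.
Qed.

Lemma continuous_section (G : R -> V -> R) q :
  joint_continuous G -> continuous (G^~ q).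
Proof.
move=> cG t.
have tq : (fun t : R => (t, q)) @ nbhs t --> (t, q).
  by apply: (@cvg_pair R R V (nbhs t) (nbhs t) (nbhs q) _ _ _ id (cst q));
    [exact: cvg_id|exact: cvg_cst].
exact: (@cvg_comp _ _ _ (fun t : R => (t, q)) (fun z => G z.1 z.2) _ _ _ tq (cG t q)).
Qed.

Variables (K : R -> V -> R) (dK : R -> V -> V -> R).
Hypothesis K_cont : joint_continuous K.
Hypothesis dK_cont : forall v, joint_continuous (fun t q => dK t q v).
Hypothesis dK_lin : forall t q (a : R) (u v : V),
  dK t q (a *: u + v) = a * dK t q u + dK t q v.
Hypothesis K_derive : forall t (q v : V) (s : R),
  is_derive s 1 (fun s => K t (q + s *: v)) (dK t (q + s *: v) v).

(** The increment splits in two: first [t] moves with [q0] frozen, where the integrand is bounded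
    near [t0]; then [q] moves, with uniform control of the integrand in time. *)
Lemma prim_param_cvg (t0 : R) (q0 : V) : 0 < t0 ->
  prim (K^~ z.2) z.1 @[z --> (t0, q0)] --> prim (K^~ q0) t0.
Proof.
move=> t00; apply/cvgrPdist_le => e e0.
have cK q := @continuous_section K q K_cont.
pose e1 := e / 2 / (t0 + 1).
have e10 : 0 < e1 by rewrite !divr_gt0// addr_gt0.
pose M := `|K t0 q0| + 1.
have M0 : 0 < M by rewrite /M ltr_wpDl.
have [d d0 dP] : exists2 d : R, 0 < d &
    forall t, `|t0 - t| < d -> `|K t q0 - K t0 q0| <= 1.
  have /cvgrPdist_le /(_ 1 ltr01) /nbhs_ballP [d /= d0 dP] := cK q0 t0.
  exists d => // t tt; rewrite distrC; apply: dP.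
  by rewrite -ball_normE.
(* In turn: [d] bounds the integrand by [M], [t0] keeps t > 0, 1 keeps t < t0 + 1, and the last term
   makes the time increment at most e / 2. *)
pose r := Num.min (Num.min d t0) (Num.min 1 (e / 2 / M)).
have r0 : 0 < r by rewrite !lt_min d0 t00 ltr01 !divr_gt0.
exists ([set t | `|t0 - t| < r],
        [set q | forall t, 0 <= t <= t0 + 1 -> `|K t q - K t q0| <= e1]).
  split => /=; last exact: near_segment.
  by apply/nbhs_ballP; exists r => //= t; rewrite -ball_normE.
move=> [t q] /= [].
rewrite /r !lt_min => /andP[/andP[td tt0] /andP[t1 te]] qe.
have /andP[t_gt0 t_lt] : 0 < t < t0 + 1.
  by move: tt0 t1; rewrite !ltr_norml => /andP[? ?] /andP[? ?]; lra.
have h1 : `|prim (K^~ q0) t0 - prim (K^~ q0) t| <= e / 2.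
  rewrite distrC.
  have := @prim_increment_dist R (K^~ q0) (K t0 q0) 1 t0 t (cK q0) (ltW t00)
    (ltW t_gt0).
  have dd s : Num.min t0 t < s < Num.max t0 t -> `|K s q0 - K t0 q0| <= 1.
    move=> h; apply: dP; move: td h; rewrite !ltr_norml.
    by case: (leP t0 t) => ? /andP[? ?] /andP[? ?]; apply/andP; lra.
  move=> /(_ dd) h.
  have : `|prim (K^~ q0) t - prim (K^~ q0) t0| <= M * `|t - t0|.
    rewrite -[X in `|X|](subrK (K t0 q0 * (t - t0))).
    by rewrite (le_trans (ler_normD _ _))// /M normrM; lra.
  move=> /le_trans; apply; rewrite -ler_pdivlMl//.
  by rewrite [leRHS]mulrC distrC ltW.
have h2 : `|prim (K^~ q0) t - prim (K^~ q) t| <= e / 2.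
  have cD : continuous (fun s => K s q0 - K s q) by exact: continuous_rB.
  have := @prim_increment_dist R _ 0 e1 0 t cD (lexx 0) (ltW t_gt0).
  rewrite prim0 mul0r !subr0 primB// (ger0_norm (ltW t_gt0)).
  have dd s : Num.min 0 t < s < Num.max 0 t -> `|K s q0 - K s q - 0| <= e1.
    rewrite (min_idPl (ltW t_gt0)) (max_idPr (ltW t_gt0)) => /andP[? ?].
    by rewrite subr0 distrC; apply: qe; apply/andP; lra.
  move=> /(_ dd) /le_trans; apply.
  by rewrite /e1 mulrAC ler_pdivrMr ?addr_gt0// ler_pM2l ?divr_gt0// ltW.
rewrite -[X in `|X|](subrKA (prim (K^~ q0) t)).
by rewrite (le_trans (ler_normD _ _))//; lra.
Qed.

Lemma prim_param_continuous (t : R) : 0 < t ->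
  continuous (fun q : V => prim (K^~ q) t).
Proof.
move=> t0 q.
have tq : (fun q : V => (t, q)) @ nbhs q --> (t, q).
  by apply: (@cvg_pair V R V (nbhs q) (nbhs t) (nbhs q) _ _ _ (cst t) id);
    [exact: cvg_cst|exact: cvg_id].
exact: (@cvg_comp _ _ _ (fun q : V => (t, q)) (fun z => prim (K^~ z.2) z.1)
  _ _ _ tq (@prim_param_cvg t q t0)).
Qed.

(** [y] represents the integral over [0, t] of the differentials of [K] at [q]. The mean value
    theorem at each time leaves a remainder that [near_segment] makes uniformly small. *)
Lemma prim_param_gateaux (t : R) (q : V) : 0 <= t ->
  exists y, forall (v : V) (e : R), 0 < e -> \forall s \near 0^'+,
    `|prim (K^~ (q + s *: v)) t - prim (K^~ q) t - s * dot y v| <= s * e.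
Proof.
move=> t0.
have cdK v := @continuous_section (fun t q => dK t q v) q (@dK_cont v).
have [|y yE] := @linear_form_dot (fun v => prim (fun s => dK s q v) t).
  move=> a u v; under eq_fun do rewrite dK_lin.
  by rewrite primD ?primZ//; apply: continuous_rM => //; exact: cst_continuous.
exists y => v e e0; rewrite -yE.
(* Integrating this tolerance over [0, t] costs at most [e], also when t = 0. *)
have e10 : 0 < e / (t + 1) by rewrite divr_gt0// ltr_wpDl.
have : \forall s \near (0 : R), forall tau, 0 <= tau <= t ->
    `|dK tau (q + s *: v) v - dK tau q v| <= e / (t + 1).
  have := @near_segment (fun tau p => dK tau p v) q t _ (@dK_cont v) e10.
  have : (fun s : R => q + s *: v) @ (0 : R) --> q + 0 *: v.
    apply: (@cvgD R V _ _ _ (cst q)); first exact: cvg_cst.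
    by apply: (@cvgZr_tmp R V); exact: cvg_id.
  by rewrite scale0r addr0; apply.
move=> /nbhs_ballP [d /= d0 dP].
near=> s.
have s0 : 0 < s by [].
have sd : s < d by near: s; exact: nbhs_right_lt.
have cK p := @continuous_section K p K_cont.
pose D tau := K tau (q + s *: v) - K tau q.
have cD : continuous D by exact: continuous_rB.
have cE : continuous (fun tau => s * dK tau q v).
  by apply: continuous_rM => //; exact: cst_continuous.
have := @prim_increment_dist R (fun tau => D tau - s * dK tau q v) 0
  (s * (e / (t + 1))) 0 t (continuous_rB cD cE) (lexx 0) t0.
rewrite prim0 mul0r !subr0 primB// primB// primZ// (ger0_norm t0) => h.
apply: le_trans (h _) _ => [tau|]; last first.
  rewrite -!mulrA ler_wpM2l ?(ltW s0)// -[leRHS]mulr1 ler_wpM2l ?(ltW e0)//.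
  by rewrite mulrC ler_pdivrMr ?ltr_wpDl//; lra.
rewrite (min_idPl t0) (max_idPr t0) subr0 => /andP[tau0 taut].
have [|c c0s] := @MVT R (fun s => K tau (q + s *: v))
    (fun s => dK tau (q + s *: v) v) 0 s s0 (fun x _ => K_derive tau q v x).
  apply: derivable_within_continuous => x _.
  by have [] := K_derive tau q v x.
rewrite scale0r addr0 subr0 /D => ->.
rewrite mulrC -mulrBr normrM (gtr0_norm s0) ler_wpM2l ?(ltW s0)//.
move: c0s; rewrite in_itv/= => /andP[c0 cs].
apply: dP; last by rewrite !ltW.
by rewrite -ball_normE /= sub0r normrN gtr0_norm// (lt_trans cs).
Unshelve. all: by end_near. Qed.

End smooth_integrand.

(** * Extension of the Hamiltonian to all times *)

Section clamped_hamiltonian.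
Context {R : realType} {n : nat}.
Notation V := 'rV[R]_n.

Lemma is_derive_approx (f : R -> R) (x l : R) :
  (forall e, 0 < e -> \forall h \near (0 : R),
     `|f (x + h) - f x - h * l| <= e * `|h|) -> is_derive x 1 f l.
Proof.
move=> fl.
have cvgl : (fun h => h^-1 *: ((f \o shift x) (h *: 1) - f x)) @ 0^' --> l.
  apply/cvgrPdist_le => e e0; near=> h.
  have h0 : h != 0 by near: h; exact: nbhs_dnbhs_neq.
  have -> : l - h^-1 *: ((f \o shift x) (h *: 1) - f x) =
      - (h^-1 * (f (x + h) - f x - h * l)).
    by rewrite mulrBr mulKf// opprB /= [h *: 1]mulr1 (addrC h).
  rewrite normrN.
  rewrite normrM normfV ler_pdivrMl ?normr_gt0// [leRHS]mulrC.
  by near: h; exact: (nbhs_dnbhs (fl e e0)).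
by split; [apply/cvg_ex; exists l|exact/cvg_lim].
Unshelve. all: by end_near. Qed.

(* [H (clamp T t) q] extends [H] from the slab to a jointly continuous function
   of all (t, q), so that no relative topology is needed any more. *)
Definition clamp (T t : R) : R := Num.max 0 (Num.min t T).

Lemma clamp_itv T t : 0 < T -> 0 <= clamp T t <= T.
Proof.
move=> T0; rewrite /clamp le_max lexx /= ge_max (ltW T0) /=.
by rewrite ge_min lexx orbT.
Qed.

Lemma clamp_id T t : 0 <= t <= T -> clamp T t = t.
Proof. by move=> /andP[t0 tT]; rewrite /clamp (min_idPl tT) (max_idPr t0). Qed.

Lemma clamp_dist T s t : `|clamp T s - clamp T t| <= `|s - t|.
Proof.
wlog st : s t / s <= t => [hw|].
  by have [/hw//|/ltW/hw] := leP s t; rewrite distrC (distrC t).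
rewrite [leRHS]distrC [leRHS]ger0_norm ?subr_ge0// ler_norml /clamp.
case: (leP s T) => ?; case: (leP t T) => ?;
  case: (leP 0 s) => ?; case: (leP 0 t) => ?; case: (leP 0 T) => ?;
  apply/andP; lra.
Qed.

(** Clamping the time is a 1-Lipschitz retraction onto the slab, so limits relative to the slab pull
    back to ordinary ones. Moves in [q] alone stay in the slab, where the relative differential
    gives derivatives along lines. *)
Lemma C1_within_clamp (T : R) (H : R -> V -> R) : 0 < T ->
  C1_within (time_slab `[0, T]) (fun z : R * V => H z.1 z.2) ->
  exists dK : R -> V -> V -> R,
  [/\ joint_continuous (fun t q => H (clamp T t) q),
      forall v, joint_continuous (fun t q => dK t q v),
      forall t q (a : R) (u v : V), dK t q (a *: u + v) = a * dK t q u + dK t q v &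
      forall t (q v : V) (s : R), is_derive s 1
        (fun s => H (clamp T t) (q + s *: v)) (dK t (q + s *: v) v)].
Proof.
move=> T0 [df [dfc dfd]].
pose A : set (R * V) := time_slab `[0, T].
pose c (z : R * V) : R * V := (clamp T z.1, z.2).
have cA z : A (c z) by rewrite /A /time_slab /= in_itv/= clamp_itv.
have c_dist w z : `|c w - c z| <= `|w - z|.
  rewrite !prod_normE /= ge_max !le_max clamp_dist /= lexx orbT.
  by [].
have c_cont z : c @ nbhs z --> within A (nbhs (c z)).
  move=> P /nbhs_ballP [d /= d0 dP]; apply/nbhs_ballP; exists d => //= w.
  rewrite -ball_normE /= => wd; apply: dP => //.
  by rewrite -ball_normE /= (le_lt_trans (c_dist _ _)).
have near_dist (z : R * V) (r : R) : 0 < r -> \forall w \near z, `|w - z| < r.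
  move=> r0; apply/nbhs_ballP; exists r => //= w.
  by rewrite -ball_normE /= distrC.
have dfE z u v a : df z (a *: u + v) = a * df z u + df z v by rewrite linearP.
have est z e : A z -> 0 < e -> exists2 d : R, 0 < d & forall w, A w ->
    `|w - z| < d -> `|H w.1 w.2 - H z.1 z.2 - df z (w - z)| <= e * `|w - z|.
  move=> Az e0; have /cvgrPdist_le /(_ e e0) := dfd z Az.
  move=> /nbhs_ballP [d /= d0 dP]; exists d => // w Aw wz.
  have [->|wz0] := eqVneq w z.
    by rewrite !subrr linear0 subr0 !normr0 mulr0.
  have := dP w; rewrite -ball_normE /= distrC => /(_ wz wz0 Aw).
  rewrite sub0r normrN normrM normfV normr_id ler_pdivrMr//.
  by rewrite normr_gt0 subr_eq0.
have dK_lin t q (a : R) (u v : V) : df (c (t, q)) (0, a *: u + v) =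
    a * df (c (t, q)) (0, u) + df (c (t, q)) (0, v).
  rewrite -dfE; congr (df _ _).
  by apply: injective_projections; rewrite /= ?scaler0 ?addr0.
exists (fun t q v => df (c (t, q)) (0, v)); split => //.
- move=> t q; apply/cvgrPdist_le => e e0.
  set z := c (t, q).
  have [|y yE] := @linear_form_dot R n (fun v => df z (0, v)).
    by move=> a u v; rewrite dK_lin.
  (* The first two terms bound the linear map [df z]; the 1 is the tolerance used in [est]. Together
     they give |H w - H z| <= M |w - z| for [w] in the slab near [z]. *)
  pose M := `|df z (1, 0)| + n%:R * `|y| + 1.
  have M0 : 0 < M by rewrite ltr_wpDl// addr_ge0// mulr_ge0.
  have [d d0 dP] := est z 1 (cA _) ltr01.
  have r0 : 0 < Num.min d (e / M) by rewrite lt_min d0 divr_gt0.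
  move: (near_dist (t, q) _ r0); apply: filterS => w.
  move=> /(le_lt_trans (c_dist _ _)); rewrite lt_min => /andP[wz /ltW wz'].
  have := dP _ (cA w) wz; rewrite mul1r distrC => h.
  set u := c w - z in h wz wz' *.
  have dfu : `|df z u| <= (`|df z (1, 0)| + n%:R * `|y|) * `|u|.
    have -> : df z u = u.1 * df z (1, 0) + df z (0, u.2).
      rewrite -dfE; congr (df _ _).
      apply: injective_projections => /=; last by rewrite scaler0 add0r.
      by rewrite addr0 [_ *: 1]mulr1.
    rewrite (le_trans (ler_normD _ _))// yE [leRHS]mulrDl lerD//.
      by rewrite normrM [leRHS]mulrC ler_wpM2r// prod_normE le_max lexx.
    rewrite (le_trans (dot_le_norm _ _))// ler_wpM2l ?mulr_ge0//.
    by rewrite prod_normE le_max lexx orbT.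
  have -> : H (clamp T t) q - H (clamp T w.1) w.2 =
      df z u - (H (c w).1 (c w).2 - H z.1 z.2) - df z u by rewrite /=; ring.
  rewrite (le_trans (ler_normB _ _))//.
  rewrite ler_pdivlMr// mulrC in wz'.
  by apply: le_trans wz'; rewrite /M mulrDl mul1r addrC lerD.
- move=> v t q.
  have /subspace_continuousP /(_ _ (cA (t, q))) := dfc (0, v).
  exact: (@cvg_comp _ _ _ c (fun z => df z (0, v) : R) _ _ _ (c_cont (t, q))).
move=> t q v s; apply: is_derive_approx => e e0.
have v0 : 0 < `|v| + 1 by rewrite ltr_wpDl.
have e10 : 0 < e / (`|v| + 1) by rewrite divr_gt0.
have [d d0 dP] := est (c (t, q + s *: v)) _ (cA _) e10.
apply/nbhs_ballP; exists (d / (`|v| + 1)); first by rewrite /= divr_gt0.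
move=> h; rewrite -ball_normE /= sub0r normrN ltr_pdivlMr// => hd.
have wzE : c (t, q + (s + h) *: v) - c (t, q + s *: v) = (0, h *: v).
  rewrite -[LHS]/(clamp T t - clamp T t, q + (s + h) *: v - (q + s *: v)) subrr.
  by rewrite scalerDl addrA (addrC _ (h *: v)) addrK.
have wzN : `|((0, h *: v) : R * V)| = `|h| * `|v|.
  by rewrite prod_normE /= normr0 normrZ max_r// mulr_ge0.
have := dP _ (cA (t, q + (s + h) *: v)); rewrite wzE wzN.
have hv : `|h| * `|v| <= `|h| * (`|v| + 1) by rewrite ler_wpM2l// lerDl.
move=> /(_ (le_lt_trans hv hd)).
have -> : df (c (t, q + s *: v)) (0, h *: v) = h * df (c (t, q + s *: v)) (0, v).
  have := dfE (c (t, q + s *: v)) (0, v) 0 h; rewrite linear0 !addr0 => <-.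
  by congr (df _ _); apply: injective_projections; rewrite /= ?scaler0.
move=> /le_trans; apply.
by rewrite mulrAC ler_pdivrMr// -mulrA ler_wpM2l// ltW.
Qed.

End clamped_hamiltonian.

(** * The Fenchel conjugate of sigma *)

Section fenchel_conjugate.
Context {R : realType} {n : nat}.
Notation V := 'rV[R]_n.
Variable sigma : V -> R.

Definition conj_dom : set V := [set q | (fenchel_conjugate sigma q < +oo)%E].

(* Equal to [0] outside [conj_dom]. *)
Definition conj (q : V) : R := fine (fenchel_conjugate sigma q).

Lemma fenchel_conjugate_leP (q : V) (c : R) :
  (fenchel_conjugate sigma q <= c%:E)%E <-> forall x, dot x q - sigma x <= c.
Proof.
split=> [h x|h].
  rewrite -lee_fin; apply: le_trans h; apply: ereal_sup_ubound.
  by exists x.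
by apply: ge_ereal_sup => _ [x _ <-]; rewrite lee_fin.
Qed.

Lemma fenchel_conjugate_gtNy (q : V) : (-oo < fenchel_conjugate sigma q)%E.
Proof.
apply: (@lt_le_trans _ _ (dot 0 q - sigma 0)%:E); first exact: ltNyr.
by apply: ereal_sup_ubound; exists 0.
Qed.

Lemma fenchel_conjugateE q : conj_dom q ->
  fenchel_conjugate sigma q = (conj q)%:E.
Proof.
by move=> Dq; rewrite fineK// fin_numElt fenchel_conjugate_gtNy.
Qed.

(** Finiteness and the bound are handled together, so that later arguments use only real affine
    inequalities. *)
Lemma conj_leP (q : V) (c : R) :
  conj_dom q /\ conj q <= c <-> forall x, dot x q - sigma x <= c.
Proof.
rewrite -fenchel_conjugate_leP; split=> [[Dq]|h].
  by rewrite fenchel_conjugateE// lee_fin.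
have Dq : conj_dom q by rewrite /conj_dom /= (le_lt_trans h)// ltry.
by split => //; rewrite -lee_fin -fenchel_conjugateE.
Qed.

Lemma young (q x : V) : conj_dom q -> dot x q - sigma x <= conj q.
Proof. by move=> Dq; apply: (conj_leP q (conj q)).1. Qed.

Lemma conj_lsc : lsc_on conj_dom conj.
Proof.
move=> g cg.
have -> : [set q | conj_dom q /\ conj q <= g q] =
    [set q | forall x, setT x -> dot x q - sigma x <= g q].
  apply/seteqP; split=> q /=; first by move=> /conj_leP + x _; apply.
  by move=> h; apply/conj_leP => x; exact: h.
apply: closed_sup_le => // x _; apply: (@continuous_rB R V).
  exact: dot_continuous.
exact: (@cst_continuous V).
Qed.

Lemma conj_convex : convex_on conj_dom conj.
Proof.
move=> a b l Da Db /andP[l0 l1]; apply/conj_leP => x.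
rewrite dotDr !dotZr.
have h0 : 0 <= 1 - l by lra.
have := ler_wpM2l l0 (young x Da); have := ler_wpM2l h0 (young x Db); lra.
Qed.

(** If |p_i| exceeds the Lipschitz constant, <x, p> - sigma x grows without bound along the i-th
    axis, which contradicts a finite conjugate. *)
Lemma conj_dom_bounded : lipschitz sigma ->
  exists L, forall p, conj_dom p -> `|p| <= L.
Proof.
move=> /pinfty_ex_gt0 [L L0 sigmaL]; exists L => p Dp.
apply: norm_rV_le; first exact: ltW.
move=> i; rewrite leNgt; apply/negP => Lp.
(* At distance [r] the growth r (|p_i| - L) exceeds by 1 what Young's inequality permits. *)
pose r := (conj p + sigma 0 + 1) / (`|p 0 i| - L).
have pL : 0 < `|p 0 i| - L by rewrite subr_gt0.
have cp0 : 0 <= conj p + sigma 0.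
  by have := young 0 Dp; rewrite dot0l; lra.
have r0 : 0 < r by rewrite divr_gt0// ltr_wpDl.
pose x : V := r *: (Num.sg (p 0 i) *: delta_mx 0 i).
have xp : dot x p = r * `|p 0 i|.
  by rewrite !dotZl dot_delta normrEsg.
have xn : `|x| <= r.
  apply: norm_rV_le => [|j]; first exact: ltW.
  rewrite !mxE eqxx /= normrM gtr0_norm// -[leRHS]mulr1 ler_wpM2l ?(ltW r0)//.
  rewrite normrM; case: (j == i) => /=; last by rewrite normr0 mulr0.
  by rewrite normr1 mulr1 normr_sg; case: (_ == _).
have : `|sigma x - sigma 0| <= L * `|x - 0| by exact: (sigmaL (x, 0)).
rewrite subr0 => /(le_trans (ler_norm _)) h.
have := young x Dp; rewrite xp => h2.
have : L * `|x| <= L * r by rewrite ler_wpM2l// ltW.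
have : r * (`|p 0 i| - L) = conj p + sigma 0 + 1 by rewrite /r divfK// gt_eqF.
by lra.
Qed.

Hypothesis sigma_convex : convex_function setT sigma.
Hypothesis sigma_diff : forall x, differentiable sigma x.

Lemma convex_functionE (x y : V) (l : R) : 0 <= l <= 1 ->
  sigma (l *: x + (1 - l) *: y) <= l * sigma x + (1 - l) * sigma y.
Proof.
move=> /andP[l0 l1].
by have := sigma_convex (Itv01 l0 l1) (in_setT x) (in_setT y).
Qed.

(** By convexity the difference quotients along x - y are at most sigma x - sigma y; their limit is
    the subgradient inequality. *)
Lemma gradient_exists (y : V) : exists p : V,
  (forall v, h^-1 * (sigma (y + h *: v) - sigma y) @[h --> (0 : R)^'+] --> dot v p) /\
  (forall x, sigma y + dot (x - y) p <= sigma x).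
Proof.
have [|p pE] := @linear_form_dot R n ('d sigma y).
  by move=> a u v; rewrite linearP.
have lim_p v : h^-1 * (sigma (y + h *: v) - sigma y) @[h --> (0 : R)^'+] --> dot v p.
  have : h^-1 *: ((sigma \o shift y) (h *: v) - sigma y) @[h --> (0 : R)^'] -->
      'D_v sigma y by exact: diff_derivable.
  rewrite deriveE// pE dotC => /cvg_dnbhs_at_right.
  rewrite (_ : (fun h => h^-1 *: _) =
      (fun h => h^-1 * (sigma (y + h *: v) - sigma y)))//.
  by apply/funext => h; rewrite /= (addrC y).
exists p; split => // x.
suff : dot (x - y) p <= sigma x - sigma y by lra.
apply: cvgr_to_le (lim_p (x - y)) _; near=> h.
have h0 : 0 < h by [].
have h1 : h <= 1 by near: h; apply: nbhs_right_le.
rewrite ler_pdivrMl//.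
have -> : y + h *: (x - y) = h *: x + (1 - h) *: y.
  by rewrite scalerBl scale1r scalerBr addrCA.
have h01 : 0 <= h <= 1 by rewrite ltW.
by have := convex_functionE x y h01; lra.
Unshelve. all: by end_near. Qed.

Lemma conj_dom_nonempty : conj_dom !=set0.
Proof.
have [p [_ pP]] := gradient_exists 0; exists p.
suff [] : conj_dom p /\ conj p <= - sigma 0 by [].
by apply/conj_leP => x; have := pP x; rewrite subr0; lra.
Qed.

(** Minimisers of the conjugate minus <y, .> are subgradients of sigma at [y], and a differentiable
    convex function has only its gradient there. *)
Lemma conj_unique_argmin (y q q' : V) :
  argmin_on conj_dom (fun q => conj q - dot y q) q ->
  argmin_on conj_dom (fun q => conj q - dot y q) q' -> q = q'.
Proof.
have [p [lim_p pP]] := gradient_exists y.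
have [Dp pmin] : conj_dom p /\ conj p <= dot y p - sigma y.
  by apply/conj_leP => x; have := pP x; rewrite dotBl; lra.
suff uniq r : argmin_on conj_dom (fun q => conj q - dot y q) r -> r = p.
  by move=> /uniq -> /uniq ->.
move=> [Dr /(_ _ Dp) rp].
have rP x : sigma y + dot (x - y) r <= sigma x.
  by have := young x Dr; rewrite dotBl; lra.
(* A subgradient is dominated by the directional derivative; the direction r - p then gives |r -
   p|^2 <= 0. *)
have le_v v : dot v r <= dot v p.
  apply: cvgr_to_ge (lim_p v) _; near=> h.
  have h0 : 0 < h by [].
  rewrite ler_pdivlMl//.
  by have := rP (y + h *: v); rewrite (addrC y) addrK dotZl; lra.
apply/eqP; rewrite -subr_eq0 -normr_eq0 -sqrf_eq0 eq_le sqr_ge0 andbT.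
rewrite (le_trans (sqr_norm_le_dot _))//.
by have := le_v (r - p); rewrite dotBr; lra.
Unshelve. all: by end_near. Qed.

End fenchel_conjugate.

(** * Uniqueness of the maximiser at intermediate times *)

Section hopf_uniqueness.
Context {R : realType} {n : nat}.
Notation V := 'rV[R]_n.

(** Convexity survives integration in time. The interval is [0, t0] for convex [K]; for concave [K]
    it is [t0, t1], applied to - K. *)
Lemma prim_increment_convex (K : R -> V -> R) (D : set V) (a b : R) :
  (forall q, continuous (K^~ q)) -> 0 <= a <= b ->
  (forall u v l, D u -> D v -> 0 <= l <= 1 -> D (l *: u + (1 - l) *: v)) ->
  (forall t u v l, a < t < b -> 0 <= l <= 1 ->
    K t (l *: u + (1 - l) *: v) <= l * K t u + (1 - l) * K t v) ->
  convex_on D (fun q => prim (K^~ q) b - prim (K^~ q) a).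
Proof.
move=> cK ab cD convK u v l Du Dv l01; split; first exact: cD.
have cZ c q : continuous (fun t => c * K t q).
  by apply: continuous_rM => //; exact: cst_continuous.
have := @prim_increment_le R (K^~ (l *: u + (1 - l) *: v))
  (fun t => l * K t u + (1 - l) * K t v) a b (cK _)
  (continuous_rD (cZ l u) (cZ (1 - l) v)) ab.
have hK t : a < t < b ->
    K t (l *: u + (1 - l) *: v) <= l * K t u + (1 - l) * K t v.
  by move=> tab; exact: convK.
by move=> /(_ hK); rewrite !primD// !primZ//; lra.
Qed.

Variables (D : set V) (s : V -> R) (L : R).
Hypothesis D_nonempty : D !=set0.
Hypothesis D_bounded : forall p, D p -> `|p| <= L.
Hypothesis s_lsc : lsc_on D s.
Hypothesis s_convex : convex_on D s.
Hypothesis s_unique : forall y q q' : V,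
  argmin_on D (fun q => s q - dot y q) q ->
  argmin_on D (fun q => s q - dot y q) q' -> q = q'.

Variables (K : R -> V -> R) (dK : R -> V -> V -> R).
Hypothesis K_cont : joint_continuous K.
Hypothesis dK_cont : forall v, joint_continuous (fun t q => dK t q v).
Hypothesis dK_lin : forall t q (a : R) (u v : V),
  dK t q (a *: u + v) = a * dK t q u + dK t q v.
Hypothesis K_derive : forall t (q v : V) (s : R),
  is_derive s 1 (fun s => K t (q + s *: v)) (dK t (q + s *: v) v).

Local Notation h t q := (prim (K^~ q) t).

Variables (t0 t1 : R).
Hypothesis t01 : 0 < t0 < t1.
Hypothesis t1_argmin : forall x, exists p,
  argmin_on D (fun q => s q + h t1 q - dot x q) = [set p].

Let cK q : continuous (K^~ q). Proof. exact: continuous_section. Qed.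

Let t0_gt0 : 0 < t0. Proof. by case/andP: t01. Qed.

Let t1_gt0 : 0 < t1. Proof. by case/andP: t01 => /lt_trans; apply. Qed.

Let D_convex u v l : D u -> D v -> 0 <= l <= 1 -> D (l *: u + (1 - l) *: v).
Proof. by move=> Du Dv l01; case: (s_convex Du Dv l01). Qed.

Let h1_convex : convex_on D (fun q => s q + h t1 q).
Proof.
apply: (unique_argmin_convex D_nonempty D_bounded _ t1_argmin).
by apply: lsc_onD => //; exact: (prim_param_continuous K_cont).
Qed.

Let gateaux0 (m : V) : exists y, forall (v : V) (e : R), 0 < e ->
  \forall r \near 0^'+, h t0 (m + r *: v) - h t0 m <= r * (dot y v + e).
Proof.
have [y yP] := prim_param_gateaux K_cont dK_cont dK_lin K_derive m (ltW t0_gt0).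
exists y => v e /(yP v); apply: filterS => r /(le_trans (ler_norm _)).
by lra.
Qed.

Let gateaux01 (m : V) : exists y, forall (v : V) (e : R), 0 < e ->
  \forall r \near 0^'+, (h t0 (m + r *: v) - h t1 (m + r *: v)) -
     (h t0 m - h t1 m) <= r * (dot y v + e).
Proof.
have [y yP] := prim_param_gateaux K_cont dK_cont dK_lin K_derive m (ltW t0_gt0).
have [y' yP'] := prim_param_gateaux K_cont dK_cont dK_lin K_derive m (ltW t1_gt0).
exists (y - y') => v e e0.
have e20 : 0 < e / 2 by rewrite divr_gt0.
near=> r.
have : `|h t0 (m + r *: v) - h t0 m - r * dot y v| <= r * (e / 2).
  by near: r; exact: yP.
have : `|h t1 (m + r *: v) - h t1 m - r * dot y' v| <= r * (e / 2).
  by near: r; exact: yP'.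
by rewrite dotBl !ler_norml => /andP[? ?] /andP[? ?]; lra.
Unshelve. all: by end_near. Qed.

(** This covers the degenerate separated cases: constant [w], or vanishing integral of [gt] up to
    [t0]. *)
Lemma unique_argmin_constant (c : R) (x p p' : V) :
  (forall q, h t0 q = c) ->
  argmin_on D (fun q => s q + h t0 q - dot x q) p ->
  argmin_on D (fun q => s q + h t0 q - dot x q) p' -> p = p'.
Proof.
move=> hc; apply: (@unique_argmin_sum R n D s (fun q => h t0 q)
  (fun q => h t0 q) 1) => //.
- by move=> u v l Du Dv l01; split; [exact: D_convex|rewrite !hc; lra].
- by move=> q; rewrite mul1r.
Qed.

Lemma unique_argmin_convexK (x p p' : V) :
  (forall t u v l, 0 < t < t1 -> 0 <= l <= 1 ->
    K t (l *: u + (1 - l) *: v) <= l * K t u + (1 - l) * K t v) ->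
  argmin_on D (fun q => s q + h t0 q - dot x q) p ->
  argmin_on D (fun q => s q + h t0 q - dot x q) p' -> p = p'.
Proof.
move=> convK; apply: (@unique_argmin_sum R n D s (fun q => h t0 q)
  (fun q => h t0 q) 1) => //.
- have t00 : (0 : R) <= 0 <= t0 by apply/andP; split => //; exact: ltW.
  have := @prim_increment_convex K D 0 t0 cK t00 D_convex.
  rewrite (_ : (fun q => _) = (fun q => h t0 q)); last first.
    by apply/funext => q; rewrite prim0 subr0.
  apply=> t u v l /andP[t_gt0 tt0]; apply: convK.
  by rewrite t_gt0 (lt_trans tt0)//; case/andP: t01.
- by move=> q; rewrite mul1r.
Qed.

(** The base function is s + h t1, convex by [h1_convex]; the remainder h t0 - h t1 is the integral
    of - K over [t0, t1]. *)
Lemma unique_argmin_concaveK (x p p' : V) :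
  (forall t u v l, 0 < t < t1 -> 0 <= l <= 1 ->
    l * K t u + (1 - l) * K t v <= K t (l *: u + (1 - l) *: v)) ->
  argmin_on D (fun q => s q + h t0 q - dot x q) p ->
  argmin_on D (fun q => s q + h t0 q - dot x q) p' -> p = p'.
Proof.
move=> concK.
have -> : (fun q => s q + h t0 q - dot x q) =
    (fun q => s q + h t1 q + (h t0 q - h t1 q) - dot x q).
  by apply/funext => q; ring.
apply: (@unique_argmin_sum R n D (fun q => s q + h t1 q)
  (fun q => h t0 q - h t1 q) (fun q => h t0 q - h t1 q) 1) => //.
- have t0t1 : 0 <= t0 <= t1 by case/andP: t01 => /ltW -> /ltW ->.
  have cNK q : continuous (fun t => - K t q).
    by move=> t; apply: cvgN; exact: cK.
  have := @prim_increment_convex (fun t q => - K t q) D t0 t1 cNK t0t1 D_convex.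
  rewrite (_ : (fun q => _) = (fun q => h t0 q - h t1 q)); last first.
    apply/funext => q.
    have NE t : prim (fun t => - K t q) t = - h t q.
      rewrite -[RHS]mulN1r -primZ//; congr prim.
      by apply/funext => ?; rewrite mulN1r.
    by rewrite !NE opprK addrC.
  apply=> t u v l /andP[tt0 tt1] l01.
  have := concK t u v l; rewrite tt1 (lt_trans t0_gt0 tt0) => /(_ isT l01); lra.
- by move=> q; rewrite mul1r.
- move=> y q q'; have [r rE] := t1_argmin y.
  by rewrite rE /= => -> ->.
Qed.

Lemma unique_argmin_separatedK (w : V -> R) (gt kt : R -> R) (x p p' : V) :
  (forall t q, K t q = gt t * w q + kt t) ->
  (forall t, 0 < t < t1 -> 0 <= gt t) \/ (forall t, 0 < t < t1 -> gt t <= 0) ->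
  argmin_on D (fun q => s q + h t0 q - dot x q) p ->
  argmin_on D (fun q => s q + h t0 q - dot x q) p' -> p = p'.
Proof.
move=> KE gt_sign.
have [/existsNP [p1 wp1]|w_cst] := pselect (~ forall q, w q = w 0); last first.
  apply: (@unique_argmin_constant (h t0 0)) => q.
  congr (prim _ _); apply/funext => t; rewrite !KE.
  by have /contrapT -> := w_cst.
have w1 : w p1 - w 0 != 0 by rewrite subr_eq0; exact/eqP.
(* No regularity of [gt] is assumed; it is recovered from [K] by comparing two points where [w]
   differs. *)
have c_gt : continuous gt.
  have -> : gt = fun t => (w p1 - w 0)^-1 * (K t p1 - K t 0).
    apply/funext => t; rewrite !KE; by field.
  by apply: continuous_rM; [exact: (@cst_continuous R)|exact: continuous_rB].
pose G := prim gt.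
(* Subtracting the value at q = 0 eliminates [kt], which may fail to be continuous. *)
have hE t q : h t q = h t 0 + (w q - w 0) * G t.
  rewrite /G -primZ// -primD//; last first.
    by apply: continuous_rM => //; exact: cst_continuous.
  by congr prim; apply/funext => r; rewrite !KE; ring.
have [G00|G0n] := eqVneq (G t0) 0.
  by apply: (@unique_argmin_constant (h t0 0)) => q; rewrite hE G00 mulr0 addr0.
pose l := G t0 / G t1.
(* Since [gt] keeps one sign, |G| is nondecreasing on the two steps from 0 to [t0] to [t1]. *)
have [G1n [l0 l1]] : G t1 != 0 /\ 0 < l /\ l <= 1.
  have t00 : (0 : R) <= 0 <= t0 by apply/andP; split => //; exact: ltW.
  have t0t1 : 0 <= t0 <= t1 by case/andP: t01 => /ltW -> /ltW ->.
  have c0 : continuous (fun _ : R => 0 : R) by exact: cst_continuous.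
  have prim00 t : 0 <= t -> prim (fun=> 0) t = 0 :> R.
    by move=> t_ge0; rewrite prim_cst// mul0r.
  have lt1 t : 0 < t < t0 -> 0 < t < t1.
    by case/andP: t01 => _ tt1 /andP[-> /lt_trans]; apply.
  have lt2 t : t0 < t < t1 -> 0 < t < t1.
    by move=> /andP[/(lt_trans t0_gt0) -> ->].
  case: gt_sign => gts.
    have := @prim_increment_le R _ _ _ _ c0 c_gt t00 (fun t h => gts t (lt1 t h)).
    have := @prim_increment_le R _ _ _ _ c0 c_gt t0t1 (fun t h => gts t (lt2 t h)).
    rewrite !prim0 !prim00 ?(ltW t0_gt0) ?(ltW t1_gt0)// !subr0
      -/(G t0) -/(G t1) => G01 G0_ge0.
    have G0_gt0 : 0 < G t0 by rewrite lt_neqAle eq_sym G0n.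
    have G1_gt0 : 0 < G t1 by lra.
    by rewrite gt_eqF// divr_gt0// ler_pdivrMr// mul1r; split => //; lra.
  have := @prim_increment_le R _ _ _ _ c_gt c0 t00 (fun t h => gts t (lt1 t h)).
  have := @prim_increment_le R _ _ _ _ c_gt c0 t0t1 (fun t h => gts t (lt2 t h)).
  rewrite !prim0 !prim00 ?(ltW t0_gt0) ?(ltW t1_gt0)// !subr0
      -/(G t0) -/(G t1) => G01 G0_le0.
  have G0_lt0 : 0 < - G t0 by rewrite oppr_gt0 lt_neqAle G0n.
  have G1_lt0 : 0 < - G t1 by lra.
  have -> : l = (- G t0) / (- G t1) by rewrite invrN mulrNN.
  rewrite divr_gt0// ler_pdivrMr// mul1r.
  by split; [rewrite lt_eqF//; lra|split => //; lra].
have l1' : 0 <= 1 - l by lra.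
have -> : (fun q => s q + h t0 q - dot x q) =
    (fun q => s q + h t1 q + (h t0 q - h t1 q) - dot x q).
  by apply/funext => q; ring.
apply: (@unique_argmin_sum R n D (fun q => s q + h t1 q)
  (fun q => h t0 q - h t1 q)
  (fun q => (1 - l) * s q + (h t0 0 - l * h t1 0)) l) => //.
- move=> u v r Du Dv r01; have [Duv suv] := s_convex Du Dv r01; split => //.
  by have := ler_wpM2l l1' suv; lra.
- move=> q _; rewrite (hE t0 q) (hE t1 q).
  have G0E : G t0 = l * G t1 by rewrite /l divfK.
  by rewrite G0E; ring.
- move=> y q q'; have [r rE] := t1_argmin y.
  by rewrite rE /= => -> ->.
Qed.

End hopf_uniqueness.

(** * Differentiability of the value function by Danskin's argument *)

Section danskin.
Context {R : realType} {n : nat}.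
Notation V := 'rV[R]_n.

(** The candidate differential of u: space gradient [p] and time derivative - c, with c = K(t,
    p). *)
Definition time_space_form (p : V) (c : R) (z : R * V) : R := dot z.2 p - z.1 * c.

Fact time_space_form_linear p c : linear (time_space_form p c).
Proof.
move=> a u v.
rewrite -[RHS]/(a * time_space_form p c u + time_space_form p c v).
rewrite -[LHS]/(dot (a *: u.2 + v.2) p - (a * u.1 + v.1) * c).
by rewrite /time_space_form dotDl dotZl; ring.
Qed.

HB.instance Definition _ p c := GRing.isLinear.Build R (R * V)%type R *:%R
  (time_space_form p c) (time_space_form_linear p c).

Lemma cvg_time_space_form {T : Type} (F : set_system T) {FF : Filter F}
    (f : T -> V) (g : T -> R) (z : T -> R * V) p c z0 :
  f @ F --> p -> g @ F --> c -> z @ F --> z0 ->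
  time_space_form (f t) (g t) (z t) @[t --> F] --> time_space_form p c z0.
Proof.
move=> fp gc zz0; apply: cvgB.
  apply: cvg_dot => //.
  exact: (cvg_comp z snd zz0 cvg_snd).
by apply: cvgM => //; exact: (cvg_comp z fst zz0 cvg_fst).
Qed.

Lemma time_space_form_continuous p c : continuous (time_space_form p c).
Proof.
move=> z; apply: (@cvg_time_space_form (R * V) (nbhs z) _ (cst p) (cst c) id);
  [exact: cvg_cst|exact: cvg_cst|exact: cvg_id].
Qed.

Lemma littleo_approx (W W' : normedModType R) (f df : W -> W') (z : W) :
  (forall e, 0 < e -> \forall w \near z,
     `|f w - f z - df (w - z)| <= e * `|w - z|) ->
  f \o shift z = cst (f z) + df +o_ 0 id.
Proof.
move=> fz; apply/eqaddoP => e /fz /nbhs_ballP [d /= d0 dP].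
apply/nbhs_ballP; exists d => //= x; rewrite -ball_normE /= sub0r normrN => xd.
have := dP (x + z); rewrite -ball_normE /= opprD addrCA subrr addr0 normrN.
by rewrite addrK => /(_ xd); rewrite opprD addrA.
Qed.

Lemma differentiable_approx (f : R * V -> R) (z : R * V) (p : V) (c : R) :
  (forall e, 0 < e -> \forall w \near z,
     `|f w - f z - time_space_form p c (w - z)| <= e * `|w - z|) ->
  differentiable f z /\ 'd f z = time_space_form p c :> (R * V -> R).
Proof.
move=> fz; have expand := littleo_approx fz.
have dE : 'd f z = time_space_form p c :> (R * V -> R).
  by apply: diff_unique => //; exact: time_space_form_continuous.
by split => //; apply/diff_locallyP; rewrite dE; split => //;
  exact: time_space_form_continuous.
Qed.

Lemma ler_norm_fst (z : R * V) : `|z.1| <= `|z|.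
Proof. by rewrite prod_normE le_max lexx. Qed.

Lemma ler_norm_snd (z : R * V) : `|z.2| <= `|z|.
Proof. by rewrite prod_normE le_max lexx orbT. Qed.

Variables (D : set V) (s : V -> R) (L : R).
Hypothesis D_nonempty : D !=set0.
Hypothesis D_bounded : forall p, D p -> `|p| <= L.
Hypothesis s_lsc : lsc_on D s.

Variables (K : R -> V -> R).
Hypothesis K_cont : joint_continuous K.

Local Notation h t q := (prim (K^~ q) t).

Variables (t1 : R).
Hypothesis argmin_unique : forall t x p p', 0 < t < t1 ->
  argmin_on D (fun q => s q + h t q - dot x q) p ->
  argmin_on D (fun q => s q + h t q - dot x q) p' -> p = p'.

Variable u : R * V -> R.
Hypothesis uE : forall t x p, 0 < t < t1 ->
  argmin_on D (fun q => s q + h t q - dot x q) p ->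
  u (t, x) = dot x p - s p - h t p.

(** Testing optimality at each of two points with the maximiser of the other squeezes the increment
    of [u]. Continuity of the maximiser makes both bounds agree to first order and makes the
    differential continuous. *)
Lemma C1_open_marginal : C1_open (time_slab `]0, t1[) u.
Proof.
pose A : set (R * V) := time_slab `]0, t1[.
have AE z : A z -> 0 < z.1 < t1 by rewrite /A /time_slab /= in_itv.
have cK q : continuous (K^~ q) by exact: continuous_section.
have /choice [p pP] : forall z : R * V, exists q, A z ->
    argmin_on D (fun q => s q + h z.1 q - dot z.2 q) q.
  move=> z; have [Az|nAz] := pselect (A z); last by exists 0.
  have /andP[z0 _] := AE z Az.
  have cN : continuous (fun q : V => - dot z.2 q).
    rewrite (_ : (fun q => _) = (fun q => 0 - dot z.2 q)); last first.
      by apply/funext => q; rewrite sub0r.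
    apply: (@continuous_rB R V); first exact: (@cst_continuous V).
    exact: dot_continuous.
  have [q qP] := argmin_on_nonempty (@compact_norm_le R n) D_nonempty D_bounded
    (lsc_onD (lsc_onD s_lsc (prim_param_continuous K_cont z0)) cN).
  by exists q.
have Anear z : A z -> \forall w \near z, A w.
  move=> /AE /andP[z0 zt]; apply/nbhs_ballP.
  exists (Num.min z.1 (t1 - z.1)) => [|w]; first by rewrite /= lt_min z0 subr_gt0.
  rewrite -ball_normE /= => /(le_lt_trans (ler_norm_fst _)) /=.
  rewrite lt_min !ltr_norml => /andP[/andP[? ?] /andP[? ?]].
  by rewrite /A /time_slab /= in_itv /=; apply/andP; lra.
have p_cont z : A z -> p @ z --> p z.
  move=> Az.
  apply: (@argmin_on_cvg R V (@compact_norm_le R n) _ D L s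
    (fun z q => h z.1 q - dot z.2 q) p z (p z) D_bounded s_lsc).
  - move=> q; have /AE /andP[z0 _] := Az.
    apply: cvgB.
      have zq : (fun zq : R * V * V => (zq.1.1, zq.2)) @ (z, q) --> (z.1, q).
        apply: (@cvg_pair (R * V * V)%type R V (nbhs (z, q)) (nbhs z.1) (nbhs q)
          _ _ _ (fun zq => zq.1.1) snd); last exact: cvg_snd.
        exact: (cvg_comp (@fst (R * V) V) fst cvg_fst cvg_fst).
      exact: (@cvg_comp _ _ _ _ (fun z : R * V => prim (K^~ z.2) z.1) _ _ _ zq
        (prim_param_cvg (q0 := q) K_cont z0)).
    apply: cvg_dot; last exact: cvg_snd.
    exact: (cvg_comp (@fst (R * V) V) snd cvg_fst cvg_snd).
  - apply: filterS (Anear z Az) => w Aw; have [Dp pmin] := pP w Aw.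
    by split => // q /pmin; lra.
  - move=> q [Dq qmin]; apply: (argmin_unique (AE z Az) _ (pP z Az)).
    by split => // r /qmin; lra.
pose F z := time_space_form (p z) (K z.1 (p z)).
have zp_cont z : A z -> (fun w => (w.1, p w)) @ z --> (z.1, p z).
  move=> Az; apply: (@cvg_pair (R * V)%type R V (nbhs z) (nbhs z.1) (nbhs (p z))
    _ _ _ fst p); [exact: cvg_fst|exact: p_cont].
have du z : A z -> differentiable u z /\ 'd u z = F z :> (R * V -> R).
  move=> Az; apply: differentiable_approx => e e0.
  have e20 : 0 < e / 2 by rewrite divr_gt0.
  set c := K z.1 (p z).
  have /cvgrPdist_le /(_ _ e20) [[B1 B2] [/= /nbhs_ballP [d /= d0 dB1] zB2] B12] :=
    @K_cont z.1 (p z).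
  (* The factor [n] comes from [dot_le_norm]. This half of [e] absorbs the cross term <w.2 - z.2, p
     w - p z>; the other half absorbs the time increment. *)
  have pd_near : \forall w \near z, n%:R * `|p w - p z| <= e / 2.
    have e30 : 0 < e / 2 / (n%:R + 1) by rewrite divr_gt0// ltr_wpDl.
    have /(@cvgrPdist_le R V) /(_ _ e30) := p_cont z Az; apply: filterS => w.
    rewrite distrC ler_pdivlMr ?ltr_wpDl// => /(le_trans _); apply.
    by rewrite mulrC ler_wpM2l// lerDl.
  have pB2_near : \forall w \near z, B2 (p w) by exact: (p_cont z Az).
  have wd_near : \forall w \near z, `|w - z| < d.
    by apply/nbhs_ballP; exists d => //= w; rewrite -ball_normE /= distrC.
  near=> w.
  have Aw : A w by near: w; exact: Anear.
  have pd : n%:R * `|p w - p z| <= e / 2 by near: w.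
  have pB2 : B2 (p w) by near: w.
  have wd : `|w - z| < d by near: w.
  have w1 : `|w.1 - z.1| <= `|w - z| := ler_norm_fst (w - z).
  have w2 : `|w.2 - z.2| <= `|w - z| := ler_norm_snd (w - z).
  have /andP[/ltW w_ge0 _] := AE w Aw; have /andP[/ltW z_ge0 _] := AE z Az.
  have hd q : B2 q ->
      `|h w.1 q - h z.1 q - c * (w.1 - z.1)| <= e / 2 * `|w.1 - z.1|.
    move=> B2q; apply: prim_increment_dist => // t tzw.
    rewrite distrC; apply: (B12 (t, q)); split => //=.
    apply: dB1; rewrite -ball_normE /=; move: (le_lt_trans w1 wd) tzw.
    rewrite !ltr_norml.
    by case: (leP z.1 w.1) => ? /andP[? ?] /andP[? ?]; apply/andP; lra.
  have [Dpw pwmin] := pP w Aw; have [Dpz pzmin] := pP z Az.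
  have := hd _ pB2; have := hd _ (nbhs_singleton zB2).
  (* The first inequality bounds the increment of [u] from below through [p z], the second from
     above through [p w]. *)
  have := pwmin _ Dpz; have := pzmin _ Dpw.
  have dd : `|dot (w.2 - z.2) (p w - p z)| <= e / 2 * `|w - z|.
    rewrite (le_trans (dot_le_norm _ _))// mulrAC ler_pM ?mulr_ge0//.
  have uw : u w = dot w.2 (p w) - s (p w) - h w.1 (p w).
    by rewrite [w in u w]surjective_pairing; apply: uE; [exact: AE|exact: pP].
  have uz : u z = dot z.2 (p z) - s (p z) - h z.1 (p z).
    by rewrite [z in u z]surjective_pairing; apply: uE; [exact: AE|exact: pP].
  have e1 : e / 2 * `|w.1 - z.1| <= e / 2 * `|w - z| by rewrite ler_pM2l.
  move: dd; rewrite uw uz /time_space_form /= !dotBl !dotBr !ler_norml.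
  move=> /andP[? ?] ? ? /andP[? ?] /andP[? ?].
  by apply/andP; lra.
split => [z /du[]//|v z Az].
have [uz dz] := du z Az.
have DE w : A w -> 'D_v u w = F w v.
  by move=> /du[dw <-]; rewrite deriveE.
suff : (fun w => 'D_v u w) @ z --> 'D_v u z by [].
rewrite DE//.
apply: (@cvg_trans _ ((fun w => F w v) @ z)).
  apply: near_eq_cvg; apply: filterS (Anear z Az) => w Aw.
  by rewrite DE.
apply: (@cvg_time_space_form (R * V)%type (nbhs z) _ p (fun w => K w.1 (p w))
  (cst v)); [exact: p_cont| |exact: cvg_cst].
exact: (cvg_comp _ (fun z => K z.1 z.2) (zp_cont z Az) (@K_cont z.1 (p z))).
Unshelve. all: by end_near. Qed.

End danskin.

(** * From the extended-real Hopf formula to real minimisation *)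

Section hopf_formula.
Context {R : realType} {n : nat}.
Notation V := 'rV[R]_n.
Variables (H : R -> V -> R) (sigma : V -> R) (t : R).

Local Notation f q := (conj sigma q + prim (H^~ q) t).

Lemma hopf_termE x q : conj_dom sigma q ->
  hopf_term H sigma t x q = (dot x q - f q)%:E.
Proof.
move=> Dq; rewrite /hopf_term fenchel_conjugateE// -!EFinB.
by congr (_%:E); rewrite /prim; ring.
Qed.

Lemma hopf_termNy x q : ~ conj_dom sigma q -> hopf_term H sigma t x q = -oo%E.
Proof.
move=> /negP; rewrite -leNgt leye_eq => /eqP sq.
by rewrite /hopf_term sq.
Qed.

Lemma hopf_term_le x p q : conj_dom sigma p ->
  (conj_dom sigma q -> f p - dot x p <= f q - dot x q) ->
  (hopf_term H sigma t x q <= hopf_term H sigma t x p)%E.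
Proof.
move=> Dp pq; have [Dq|nDq] := pselect (conj_dom sigma q).
  by rewrite !hopf_termE// lee_fin; have := pq Dq; lra.
by rewrite (hopf_termNy _ nDq) leNye.
Qed.

(** A point of finite conjugate excludes maximisers of value -oo, so a maximiser lies in the domain
    and the comparison becomes one of reals. *)
Lemma ell_argmin x : conj_dom sigma !=set0 ->
  ell H sigma t x = argmin_on (conj_dom sigma) (fun q => f q - dot x q).
Proof.
move=> [q0 Dq0]; apply/seteqP; split=> p /=.
  move=> pmax; have Dp : conj_dom sigma p.
    apply: contrapT => nDp; have := pmax q0.
    by rewrite (hopf_termNy _ nDp) hopf_termE.
  split=> // q Dq; have := pmax q.
  by rewrite !hopf_termE// lee_fin; lra.
by move=> [Dp pmin] q; apply: hopf_term_le => // /pmin.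
Qed.

Lemma hopf_solutionE x p :
  argmin_on (conj_dom sigma) (fun q => f q - dot x q) p ->
  hopf_solution H sigma t x = dot x p - f p.
Proof.
move=> [Dp pmin]; rewrite /hopf_solution.
suff -> : ereal_sup [set hopf_term H sigma t x q | q in setT] =
    hopf_term H sigma t x p by rewrite hopf_termE.
apply/eqP; rewrite eq_le; apply/andP; split.
  by apply: ge_ereal_sup => _ [q _ <-]; apply: hopf_term_le => // /pmin.
by apply: ereal_sup_ubound; exists p.
Qed.

End hopf_formula.

(** * Assembly of the three cases of (A2) *)

Theorem theorem3p2 (R : realType) (n : nat) (T : R)
    (H : R -> 'rV[R]_n -> R) (sigma : 'rV[R]_n -> R) (tstar : R)
    (T_gt0 : 0 < T)
    (H_C1 : C1_within (@time_slab R n `[0, T]) (fun z => H z.1 z.2))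
    (sigma_convex : convex_function setT sigma)
    (sigma_C1 : C1_open setT sigma)
    (A1 : condA1 T H sigma)
    (A2 : condA2 T H)
    (sigma_lipschitz : lipschitz sigma)
    (tstar_range : 0 < tstar <= T)
    (ell_singleton : forall x : 'rV[R]_n,
       exists p : 'rV[R]_n, ell H sigma tstar x = [set p]) :
  C1_open (@time_slab R n `]0, tstar[)
    (fun z => hopf_solution H sigma z.1 z.2).
Proof.
have [dK [K_cont dK_cont dK_lin K_derive]] := C1_within_clamp T_gt0 H_C1.
have /andP[tstar_gt0 tstarT] := tstar_range.
pose K t q := H (clamp T t) q.
have sigma_diff x : differentiable sigma x by apply: sigma_C1.1.
have D0 := conj_dom_nonempty sigma_convex sigma_diff.
have [L DL] := conj_dom_bounded sigma_lipschitz.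
(* Up to time T the integrals see only times at which the clamp is the identity. *)
have primHK t q : 0 <= t <= T -> prim (H^~ q) t = prim (K^~ q) t.
  move=> /andP[t0 tT]; apply: eq_Rintegral => s.
  rewrite inE /= in_itv /= => /andP[s0 st].
  by rewrite /K clamp_id// s0 (le_trans st).
have clampE r : 0 < r < tstar -> clamp T r = r.
  by move=> /andP[r0 rt]; rewrite clamp_id// !ltW// (lt_le_trans rt).
have costE t y : 0 <= t <= T ->
    (fun q => conj sigma q + prim (H^~ q) t - dot y q) =
    (fun q => conj sigma q + prim (K^~ q) t - dot y q).
  by move=> tT; apply/funext => q; rewrite primHK.
apply: (@C1_open_marginal R n _ _ L D0 DL (@conj_lsc R n sigma) K K_cont); last first.
  move=> t x p /andP[t0 tt] pmin.
  have tT : 0 <= t <= T by rewrite !ltW// (lt_le_trans tt).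
  by rewrite (@hopf_solutionE _ _ _ _ _ x p) ?costE// primHK// opprD addrA.
(* What remains is uniqueness at an intermediate time [t], with [tstar] as the later time where
   uniqueness is given. *)
move=> t x p p' t0tt.
have lsc_s := @conj_lsc R n sigma.
have cvx_s := @conj_convex R n sigma.
have uniq_s := @conj_unique_argmin R n sigma sigma_convex sigma_diff.
have tstar_min y : exists q,
    argmin_on (conj_dom sigma)
      (fun q => conj sigma q + prim (K^~ q) tstar - dot y q) = [set q].
  have [q] := ell_singleton y; rewrite ell_argmin// costE; last by rewrite ltW.
  by exists q.
have tT r : 0 < r < tstar -> 0 < r < T.
  by move=> /andP[-> /lt_le_trans]; apply.
case: A2 => [[convH|concH]|[g [h [k [HE gsign]]]]].
- apply: (unique_argmin_convexK cvx_s uniq_s K_cont dK_cont dK_lin K_derive t0tt).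
  move=> r u v l rt l01; rewrite clampE//.
  exact: (convex_functionE (convH r (tT r rt))).
- apply: (unique_argmin_concaveK D0 DL lsc_s cvx_s K_cont dK_cont dK_lin K_derive
    t0tt tstar_min).
  move=> r u v l rt l01; rewrite clampE//.
  by have := convex_functionE (concH r (tT r rt)) u v l01; lra.
- apply: (unique_argmin_separatedK D0 DL lsc_s cvx_s uniq_s K_cont dK_cont dK_lin
    K_derive t0tt tstar_min (w := h) (gt := g \o clamp T) (kt := k \o clamp T)).
    by move=> r q; rewrite HE ?clamp_itv.
  by case: gsign => gs; [left|right] => r rt; rewrite /= clampE//; exact: gs (tT r rt).
Qed.
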